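(* Let $X=(X,d,\mu)$ be an unbounded metric space equipped with a doubling measure $\mu$. Assume that $X$ supports a $(1,1)$-Poincaré inequality, that there is a constant $C^*>0$ such that the reverse doubling condition $$\frac{\mu(B(y,r))}{\mu(B(x,R))}\le C^*\,\frac rR$$ holds whenever $B(y,r)\subset B(x,R)\subset X$, and that there are $Q>1$ and $c>0$ such that $\mu(B)\ge c\operatorname{rad}(B)^Q$ for all balls $B\subset X$. Let $\emptyset\neq E\subset X$ be a closed set, write $\delta_E(x)=\operatorname{dist}(x,E)$, and let $1<p\le q\le Qp/(Q-p)<\infty$ and $\beta\in\mathbb{R}$ be such that $$\underline{\mathrm{co\,dim}}_A(E)>\max\Bigl\{Q-\frac qp(Q-p+\beta),\ \frac{\beta}{p-1}\Bigr\}.$$ Then there is a constant $C>0$ such that the weighted Hardy--Sobolev inequality $$\Bigl(\int_X|f(x)|^q\,\delta_E(x)^{(q/p)(Q-p+\beta)-Q}\,d\mu(x)\Bigr)^{1/q}\le C\Bigl(\int_X g(x)^p\,\delta_E(x)^{\beta}\,d\mu(x)\Bigr)^{1/p}$$ holds whenever $f\in\operatorname{Lip}_0(X)$ and $g$ is an upper gradient of $f$.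
   Context: $X=(X,d,\mu)$ is a metric space with a Borel measure $\mu$ supported on $X$ such that $0<\mu(B)<\infty$ for every open ball $B=B(x,r)=\{y\in X:d(x,y)<r\}$, $x\in X$, $r>0$. Each ball $B$ comes with a fixed center $x_B$ and radius $\operatorname{rad}(B)$, and $\ell B=B(x_B,\ell\operatorname{rad}(B))$ for $\ell>0$. The measure $\mu$ is doubling: there is $C_D>0$ with $\mu(B(x,2r))\le C_D\,\mu(B(x,r))$ for all $x\in X$, $r>0$. A Borel function $g\ge0$ on $X$ is an upper gradient of a measurable function $f\colon X\to\mathbb{R}$ if $|f(y)-f(x)|\le\int_\gamma g\,ds$ for all compact rectifiable curves $\gamma$ in $X$, where $x,y$ are the endpoints of $\gamma$. $X$ supports a $(1,1)$-Poincaré inequality if there are constants $C_P>0$ and $\tau\ge1$ such that whenever $B$ is a ball in $X$ and $g$ is an upper gradient of a measurable function $f\colon X\to\mathbb{R}$, $$\frac1{\mu(B)}\int_B|f-f_B|\,d\mu\le C_P\operatorname{rad}(B)\,\frac1{\mu(\tau B)}\int_{\tau B}g\,d\mu,\qquad f_B=\frac1{\mu(B)}\int_B f\,d\mu,$$ where the right-hand side is interpreted as $\infty$ if $f_B$ is not defined. For $E\subset X$ and $r>0$ let $E_r=\{x\in X:\operatorname{dist}(x,E)<r\}$. The lower Assouad codimension $\underline{\mathrm{co\,dim}}_A(E)$ is the supremum of all $\rho\ge0$ for which there is a constant $C\ge1$ such that $\mu(E_r\cap B(x,R))/\mu(B(x,R))\le C(r/R)^{\rho}$ for every $x\in E$ and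 all $0<r<R<2\operatorname{diam}(X)$. $\operatorname{Lip}_0(X)$ is the set of all Lipschitz functions $f\colon X\to\mathbb{R}$ for which there is a ball $B$ with $f=0$ on $X\setminus B$. The constant $C$ in the inequality is independent of $f$ and $g$. *)

(* Defs.v *)
From HB Require Import structures.
From mathcomp Require Import all_boot all_order all_algebra.
From mathcomp Require Import all_classical all_reals all_analysis.
From mathcomp Require Import measurable_realfun.

Set Implicit Arguments.
Unset Strict Implicit.
Unset Printing Implicit Defensive.

Import Order.TTheory GRing.Theory Num.Theory.
Import numFieldNormedType.Exports.

Local Open Scope classical_set_scope.
Local Open Scope ring_scope.

(* [g_sigma_algebraType] asks for a pointed carrier, and [metricType] is not
   pointed: hence this join, which only says that the space is nonempty. *)
#[short(type="pmetricType")]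
HB.structure Definition PointedMetric (K : numDomainType) :=
  {M of Pointed M & Metric K M}.

Notation borelType X := (g_sigma_algebraType (@open X)).

Section metric_notions.
Context {R : realType} {X : pmetricType R}.
Implicit Types (x y : X) (E : set X) (f : X -> R) (r a b s t : R).

Definition dist_set E x : R := inf [set mdist x y | y in E].

Definition ediam E : \bar R :=
  ereal_sup [set z | exists x y, [/\ E x, E y & z = (mdist x y)%:E]].

Definition unbounded : Prop := ediam setT = +oo%E.

Definition neighborhood E r : set X := [set x | dist_set E x < r].

Definition Lip0 f : Prop :=
  (exists L : R, forall x y, `|f x - f y| <= L * mdist x y) /\
  (exists x r, 0 < r /\ forall y, ~ ball x r y -> f y = 0).

Definition curve_length (gamma : R -> X) a b : \bar R :=
  ereal_sup [set (\sum_(i < size s)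
      mdist (gamma (nth a (a :: s) i)) (gamma (nth a s i)))%:E
    | s in [set s : seq R | itv_partition a b s]].

Definition rectifiable_curve (gamma : R -> X) a b : Prop :=
  [/\ a <= b, {within `[a, b], continuous gamma}
    & (curve_length gamma a b < +oo)%E].

(* The arc-length parametrization: the point of the curve at which the length
   run from [gamma a] first reaches [s], for [0 <= s <= curve_length gamma a b]. *)
Definition arc_param (gamma : R -> X) a b s : X :=
  gamma (inf [set t | a <= t <= b /\ (s%:E <= curve_length gamma a t)%E]).

Definition line_integral (g : X -> \bar R) (gamma : R -> X) a b : \bar R :=
  (\int[@lebesgue_measure R]_(s in `[0%R, fine (curve_length gamma a b)])
     g (arc_param gamma a b s))%E.

Definition upper_gradient (g : X -> \bar R) f : Prop :=
  [/\ measurable_fun setT (g : borelType X -> \bar R),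
      forall x, (0 <= g x)%E
    & forall (gamma : R -> X) a b, rectifiable_curve gamma a b ->
        ((`|f (gamma b) - f (gamma a)|)%:E <= line_integral g gamma a b)%E].

End metric_notions.

Section metric_measure_notions.
Context {R : realType} {X : pmetricType R}.
Variable mu : {measure set (borelType X) -> \bar R}.
Implicit Types (x y : X) (E : set X) (f : X -> R) (g : X -> \bar R).

Definition balls_positive_finite : Prop :=
  forall x (r : R), 0 < r -> (0 < mu (ball x r) < +oo)%E.

Definition doubling : Prop :=
  exists CD : R, 0 < CD /\
    forall x (r : R), 0 < r -> (mu (ball x (2 * r)) <= CD%:E * mu (ball x r))%E.

Definition average (A : set X) g : \bar R :=
  ((\int[mu]_(y in A) g y) / mu A)%E.

(* [f_B] is considered to be defined when [f] is integrable over [B]. *)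
Definition poincare11 : Prop :=
  exists CP tau : R, [/\ 0 < CP, 1 <= tau &
    forall x (r : R) f g, 0 < r ->
      measurable_fun setT (f : borelType X -> R) ->
      upper_gradient g f ->
      mu.-integrable (ball x r) (EFin \o f) ->
      (average (ball x r)
         (fun y => (`|(f y)%:E - average (ball x r) (EFin \o f)|))
       <= (CP * r)%:E * average (ball x (tau * r)) g)%E].

Definition reverse_doubling : Prop :=
  exists Cstar : R, 0 < Cstar /\
    forall x y (r s : R), 0 < r -> 0 < s -> ball y r `<=` ball x s ->
      (mu (ball y r) / mu (ball x s) <= (Cstar * (r / s))%:E)%E.

Definition lower_mass_bound (Q : R) : Prop :=
  exists c : R, 0 < c /\
    forall x (r : R), 0 < r -> ((c * r `^ Q)%:E <= mu (ball x r))%E.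

Definition lower_codim_Assouad E : \bar R :=
  ereal_sup [set rho%:E | rho in [set rho : R | 0 <= rho /\
    exists C : R, 1 <= C /\
      forall x (r s : R), E x -> 0 < r -> r < s ->
        (s%:E < 2%:E * ediam [set: X])%E ->
        (mu (neighborhood E r `&` ball x s) / mu (ball x s)
         <= (C * (r / s) `^ rho)%:E)%E]].

End metric_measure_notions.

(* [powR] sends [0 `^ s] to [0] also for [s < 0]; a weight [delta_E ^ s] is
   infinite on [E] in that case. *)
Definition powR_infty {R : realType} (a s : R) : \bar R :=
  if (a == 0) && (s < 0) then +oo%E else (a `^ s)%:E.

(* Main.v *)
Require Import Defs.
From HB Require Import structures.
From mathcomp Require Import all_boot all_order all_algebra.
From mathcomp Require Import all_classical all_reals all_analysis.
From mathcomp Require Import measurable_realfun.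
From mathcomp Require Import ring lra.

Set Implicit Arguments.
Unset Strict Implicit.
Unset Printing Implicit Defensive.

Import Order.TTheory GRing.Theory Num.Theory.
Import numFieldNormedType.Exports.

Local Open Scope classical_set_scope.
Local Open Scope ring_scope.

(** Write [d] for the distance to [E], [Avg r g x] for the mean of [g] over
[B(x, r)], and [s = q/p (Q - p + beta) - Q].

Telescoping the means of [f] over concentric balls, the Poincaré inequality
bounds [|f x|] by a constant times [sum_k r_k Avg r_k g x], where [r_k] runs
over dyadic scales ([le_sum_avg]). It remains to bound this positive linear
operator from [L^p(d^beta)] to [L^q(d^s)].

On most of [B(x, r)] the distance to [E] is of the size of [m = max(r, d x)]. Any power
[d^a] with [- a] below the codimension of [E] has mean at most [C m^a] over the
ball ([integral_dist_powR]), because the layers of a ball at small distance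
from [E] occupy geometrically decreasing fractions of it. The hypothesis on the
codimension says that [d^s] and [d^(- beta/(p-1))] are such powers, and since
it is strict, both exponents may be lowered a little. Hölder's inequality on
one ball, with this room used to insert small powers of [d], and the lower mass
bound give for each scale an estimate in which all powers of [r], [d x] and [m]
cancel except for [(r/m)^(theta q)], [theta = 1 + Q/q - Q/p >= 0], and small
powers of [d x / m]. If [theta > 0], these factors decay geometrically for
scales below and above [d x], so the inserted powers serve as weights of a
Schur test: the sum over the scales converges, and means are moved to the other
side by Tonelli's theorem ([avg_swap]). This is [operator_bound_positive].

If [theta = 0], that is [q = Q p / (Q - p)], there is no decay at scales below
[d x], and the argument covers only those with [r >= d x / 2]. On smaller balls
the weight is almost constant, and what remains is the unweighted endpoint
bound for the fractional integral of order one ([fractional_integration]). It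
is proved by cutting the function at a height depending on the scale.

Sums over the scales are finite throughout, with constants independent of the
smallest scale and of the number of scales: the error in the telescoping can be
made uniformly small, and the inequality is proved on the sets
[2 / (m + 1) <= |f|] before [m] tends to infinity. *)

(** * Powers and dyadic sums *)

Section real_sums.
Context {R : realType}.
Implicit Types (a e t q u w x y W : R) (n : nat).

Lemma eq_ler x y : x = y -> x <= y.
Proof. by move=> ->. Qed.

Lemma powR_expR x a : 0 < x -> x `^ a = expR (a * ln x).
Proof. by move=> x0; rewrite /powR gt_eqF. Qed.

Lemma powR1r a : 1 `^ a = 1 :> R.
Proof. by rewrite powR1. Qed.

Lemma powR_le x y a : 0 <= a -> 0 <= x -> x <= y -> x `^ a <= y `^ a.
Proof.
by move=> a0 x0 xy; apply: ge0_ler_powR; rewrite ?nnegrE// (le_trans x0).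
Qed.

Lemma powR_le1 x a : 0 <= a -> 0 <= x -> x <= 1 -> x `^ a <= 1.
Proof. by move=> a0 x0 x1; rewrite -(powR1r a) powR_le. Qed.

Lemma powR_leN x y a : a <= 0 -> 0 < x -> x <= y -> y `^ a <= x `^ a.
Proof.
move=> a0 x0 xy; have y0 := lt_le_trans x0 xy.
by rewrite !powR_expR// ler_expR ler_wnM2l// ler_ln.
Qed.

Lemma powR_comparable x y a : 0 < x -> 0 < y -> x <= 2 * y -> y <= 2 * x ->
  x `^ a <= 2 `^ `|a| * y `^ a.
Proof.
move=> x0 y0 xy yx; have [a0|a0] := ger0P a.
  by rewrite -powRM ?(ltW y0)// powR_le// ltW.
rewrite [X in _ <= X * _](_ : _ = (2^-1 : R) `^ a); last first.
  by rewrite -[2^-1]powR_inv1// -powRrM mulN1r.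
by rewrite -powRM ?(ltW y0)// powR_leN ?(ltW a0)//; [rewrite mulr_gt0|lra].
Qed.

Lemma powR_add_le x y a : 0 <= a -> 0 <= x -> 0 <= y ->
  (x + y) `^ a <= 2 `^ a * (x `^ a + y `^ a).
Proof.
move=> a0; wlog xy : x y / x <= y => [H x0 y0|x0 y0].
  have [xy|yx] := leP x y; first exact: H.
  by rewrite addrC [X in 2 `^ a * X]addrC H// ltW.
apply: (@le_trans _ _ ((2 * y) `^ a)).
  by apply: powR_le; rewrite ?addr_ge0//; lra.
by rewrite powRM// ler_wpM2l ?powR_ge0// lerDr powR_ge0.
Qed.

Lemma powRK x a : a != 0 -> 0 <= x -> (x `^ a) `^ a^-1 = x.
Proof. by move=> a0 x0; rewrite -powRrM mulfV// powRr1. Qed.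

Lemma powRKV x a : a != 0 -> 0 <= x -> (x `^ a^-1) `^ a = x.
Proof. by move=> a0 x0; rewrite -powRrM mulVf// powRr1. Qed.

Lemma powR_gt1 x a : 1 < x -> 0 < a -> 1 < x `^ a.
Proof.
move=> x1 a0; rewrite powR_expR ?(lt_trans _ x1)// expR_gt1 mulr_gt0//.
by rewrite ln_gt0.
Qed.

Lemma sum_dyadic_recl (P : pred R) (F : R -> R) t n :
  \sum_(k < n.+1 | P (t * 2 ^+ k)) F (t * 2 ^+ k) =
  (if P t then F t else 0) +
  \sum_(k < n | P (2 * t * 2 ^+ k)) F (2 * t * 2 ^+ k).
Proof.
rewrite big_mkcond big_ord_recl expr0 mulr1; congr (_ + _).
rewrite [RHS]big_mkcond; apply: eq_bigr => k _.
by rewrite lift0 exprS mulrA (mulrC t).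
Qed.

(** The terms of a geometric sum that are at most one add up to a constant that
depends only on the ratio: the correction [- A t^e] makes the induction on the
number of terms work. *)
Lemma sum_dyadic_le1 e : 0 < e -> exists2 K : R, 0 < K &
  forall t n, 0 < t ->
    \sum_(k < n | t * 2 ^+ k <= 1) (t * 2 ^+ k) `^ e <= K.
Proof.
move=> e0; pose s : R := 2 `^ e.
have s1 : 1 < s by apply: powR_gt1 => //; rewrite ltr1n.
pose A := (s - 1)^-1; have A0 : 0 < A by rewrite invr_gt0 subr_gt0.
exists (1 + A) => [|t n]; first lra.
suff H : forall t, 0 < t -> t <= 1 ->
    \sum_(k < n | t * 2 ^+ k <= 1) (t * 2 ^+ k) `^ e <= 1 + A - A * t `^ e.
  move=> t0; have [t1|t1] := leP t 1.
    apply: le_trans (H t t0 t1) _; rewrite lerBlDr lerDl.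
    by rewrite mulr_ge0 ?powR_ge0// ltW.
  rewrite big_pred0 ?addr_ge0 ?ltW// => k; apply/negbTE; rewrite -ltNge.
  by rewrite (lt_le_trans t1)// ler_peMr ?(ltW t0)// exprn_ege1// ler1n.
elim: n => [|n IH] {}t t0 t1.
  have : t `^ e <= 1 := powR_le1 (ltW e0) (ltW t0) t1.
  by rewrite big_ord0; nra.
rewrite (sum_dyadic_recl (fun x => x <= 1) (fun x => x `^ e)) t1.
have As : A * s = 1 + A by rewrite /A; field; rewrite gt_eqF ?subr_gt0.
have te0 := powR_ge0 t e.
have [t2|t2] := leP (2 * t) 1.
  have := IH (2 * t) (mulr_gt0 (ltr0Sn _ _) t0) t2.
  have -> : (2 * t) `^ e = s * t `^ e by rewrite powRM ?(ltW t0).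
  by rewrite mulrA As; lra.
rewrite big_pred0 ?addr0; last first.
  move=> k; apply/negbTE; rewrite -ltNge (lt_le_trans t2)//.
  by rewrite ler_peMr ?exprn_ege1 ?ler1n// ltW// mulr_gt0.
have : t `^ e <= 1 := powR_le1 (ltW e0) (ltW t0) t1.
by move: A0 => /ltW A0; nra.
Qed.

Lemma sum_dyadic_ge1 e : 0 < e -> exists2 K : R, 0 < K &
  forall t n, 0 < t ->
    \sum_(k < n | 1 <= t * 2 ^+ k) (t * 2 ^+ k) `^ (- e) <= K.
Proof.
move=> e0; pose s : R := 2 `^ (- e).
have s0 : 0 < s by apply: powR_gt0.
have s1 : s < 1.
  by rewrite /s powRN invf_lt1 ?powR_gt0//; apply: powR_gt1 => //; rewrite ltr1n.
pose K := (1 - s)^-1; have K0 : 0 < K by rewrite invr_gt0 subr_gt0.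
exists K => // t n.
suff H : forall t, 0 < t ->
    \sum_(k < n | 1 <= t * 2 ^+ k) (t * 2 ^+ k) `^ (- e) <= K /\
    (1 <= t -> \sum_(k < n | 1 <= t * 2 ^+ k) (t * 2 ^+ k) `^ (- e)
      <= K * t `^ (- e)).
  by move=> t0; case: (H t t0).
elim: n => [|n IH] {}t t0.
  by rewrite !big_ord0; split=> [|_]; rewrite ?mulr_ge0 ?powR_ge0 ?ltW.
rewrite (sum_dyadic_recl (fun x => 1 <= x) (fun x => x `^ (- e))).
have [IH1 IH2] := IH (2 * t) (mulr_gt0 (ltr0Sn _ _) t0).
have [t1|t1] := leP 1 t; last by rewrite add0r; split.
have Ks : K * s = K - 1 by rewrite /K; field; rewrite gt_eqF ?subr_gt0.
have {}IH2 : \sum_(k < n | 1 <= 2 * t * 2 ^+ k) (2 * t * 2 ^+ k) `^ (- e)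
    <= (K - 1) * t `^ (- e).
  have E : (2 * t) `^ (- e) = s * t `^ (- e) by rewrite powRM ?(ltW t0).
  by rewrite -Ks -mulrA -E; apply: IH2; lra.
have te1 : t `^ (- e) <= 1.
  by rewrite -(powR1r (- e)) powR_leN// oppr_le0 ltW.
have te0 := powR_ge0 t (- e).
split=> [|_]; last lra.
have : K * t `^ (- e) <= K by rewrite ler_piMr// ltW.
lra.
Qed.

(** With [w] the weights of a convergent series, this replaces Hölder's
inequality for sums when constants do not matter: no quotient [b i / w i]
exceeds the [l^q]-norm of all of them, so the conjugate exponent never
appears. *)
Lemma powR_sum_weight (I : finType) (P : pred I) (b w : I -> R) q W :
  0 < q -> (forall i, P i -> 0 < w i) -> (forall i, P i -> 0 <= b i) ->
  \sum_(i | P i) w i <= W ->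
  (\sum_(i | P i) b i) `^ q <= W `^ q * \sum_(i | P i) b i `^ q * w i `^ (- q).
Proof.
move=> q0 w0 b0 wW.
have F0 i : 0 <= b i `^ q * w i `^ (- q) by rewrite mulr_ge0 ?powR_ge0.
set S := \sum_(i | P i) (b i `^ q * _).
have S0 : 0 <= S by apply: sumr_ge0.
have sw : 0 <= \sum_(i | P i) w i by apply: sumr_ge0 => i Pi; rewrite ltW ?w0.
have bN i : P i -> b i <= S `^ q^-1 * w i.
  move=> Pi; have bi : b i `^ q * w i `^ (- q) <= S.
    by rewrite /S (bigD1 i)//= lerDl sumr_ge0.
  rewrite -ler_pdivrMr ?w0// -[leLHS](@powRK _ q) ?gt_eqF//; last first.
    by rewrite divr_ge0 ?b0// ltW ?w0.
  apply: powR_le; rewrite ?invr_ge0 ?powR_ge0 ?(ltW q0)//.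
  rewrite powRM ?b0 ?invr_ge0 ?(ltW (w0 _ Pi))//.
  by rewrite -powR_inv1 ?(ltW (w0 _ Pi))// -powRrM mulN1r.
apply: (@le_trans _ _ ((S `^ q^-1 * W) `^ q)).
  apply: powR_le; rewrite ?(ltW q0)//; first by apply: sumr_ge0.
  apply: (le_trans (ler_sum _ bN)).
  by rewrite -mulr_sumr ler_wpM2l ?powR_ge0.
by rewrite powRM ?powR_ge0 ?(le_trans sw)// powRKV ?gt_eqF// mulrC.
Qed.

(** For [b_k <= C r_k^-a] with [r_k] dyadic, the terms with small [r_k^-a]
contribute at most half of the sum [S]; on the others [r_k^-a] is at least a
multiple of [S], and [S^(q-u)] is absorbed by [r_k^(-a (q-u))]. *)
Lemma powR_sum_decay a q u M : 0 < a -> 0 < u -> u < q -> 0 < M ->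
  exists2 C : R, 0 < C & forall eps n (b : 'I_n -> R), 0 < eps ->
  (forall k, 0 <= b k <= M * (eps * 2 ^+ k) `^ (- a)) ->
  (\sum_k b k) `^ q <=
    C * \sum_k b k `^ u * (eps * 2 ^+ k) `^ (- (a * (q - u))).
Proof.
move=> a0 u0 uq M0.
have [K K0 HK] := sum_dyadic_ge1 a0.
pose e := a * (q - u) / u.
have e0 : 0 < e by rewrite divr_gt0 ?mulr_gt0 ?subr_gt0.
have [L L0 HL] := sum_dyadic_le1 e0.
pose sg := (2 * M * K)^-1; have sg0 : 0 < sg by rewrite invr_gt0 !mulr_gt0.
exists (2 `^ u * L `^ u * sg `^ (- (q - u))).
  by rewrite !mulr_gt0// powR_gt0.
move=> eps n b eps0 Hb; have b0 k : 0 <= b k by case/andP: (Hb k).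
set S := \sum_k b k.
have S0 : 0 <= S by apply: sumr_ge0.
have q0 : 0 < q by apply: lt_trans uq.
have [->|SN0] := eqVneq S 0.
  rewrite powR0 ?gt_eqF// !mulr_ge0 ?powR_ge0// sumr_ge0// => k _.
  by rewrite mulr_ge0 ?powR_ge0.
have {SN0}S0 : 0 < S by rewrite lt0r SN0.
have sS0 : 0 < sg * S by rewrite mulr_gt0.
(* so that t 2^k <= 1 holds exactly when r_k^-a is at least sg S *)
pose t := eps * (sg * S) `^ a^-1.
have t0 : 0 < t by rewrite mulr_gt0// powR_gt0.
have tk (k : nat) : t * 2 ^+ k = (eps * 2 ^+ k) * (sg * S) `^ a^-1.
  by rewrite /t mulrAC.
have rk0 (k : nat) : 0 < eps * 2 ^+ k by rewrite mulr_gt0// exprn_gt0.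
have ta (k : nat) : (eps * 2 ^+ k) `^ (- a) = sg * S * (t * 2 ^+ k) `^ (- a).
  rewrite tk (@powRM _ (eps * 2 ^+ k) (_ `^ _)) ?powR_ge0 ?(ltW (rk0 _))//.
  rewrite -powRrM mulrN mulVf ?gt_eqF//.
  by rewrite powR_inv1 ?(ltW sS0)// mulrCA mulfV ?gt_eqF// mulr1.
have half : S / 2 <= \sum_(k < n | t * 2 ^+ k <= 1) b k.
  have : \sum_(k < n | ~~ (t * 2 ^+ k <= 1)) b k <= S / 2.
    apply: (@le_trans _ _ (\sum_(k < n | 1 <= t * 2 ^+ k)
        M * (sg * S) * (t * 2 ^+ k) `^ (- a))).
      rewrite big_mkcond [leRHS]big_mkcond/=; apply: ler_sum => k _.
      have [tk1|tk1] := ltP 1 (t * 2 ^+ k).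
        by rewrite (ltW tk1)/= -mulrA -ta; case/andP: (Hb k).
      by case: ifP => // _; rewrite !mulr_ge0 ?powR_ge0 ?ltW.
    rewrite -mulr_sumr; apply: le_trans (ler_wpM2l _ (HK t n t0)) _.
      by rewrite !mulr_ge0 ?ltW.
    apply: eq_ler.
    by rewrite /sg; field; rewrite !gt_eqF.
  have : S = \sum_(k < n | t * 2 ^+ k <= 1) b k +
      \sum_(k < n | ~~ (t * 2 ^+ k <= 1)) b k.
    by rewrite /S (bigID (fun k : 'I_n => t * 2 ^+ k <= 1)).
  lra.
have := @powR_sum_weight 'I_n (fun k => t * 2 ^+ k <= 1) b
  (fun k => (t * 2 ^+ k) `^ e) u L u0.
move=> /(_ (fun k _ => powR_gt0 _ (mulr_gt0 t0 (exprn_gt0 _ (ltr0Sn _ _))))).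
move=> /(_ (fun k _ => b0 k) (HL t n t0)) H.
have {H} : (S / 2) `^ u <= L `^ u * ((sg * S) `^ (- (q - u)) *
    \sum_k b k `^ u * (eps * 2 ^+ k) `^ (- (a * (q - u)))).
  apply: le_trans (le_trans H _).
    by apply: powR_le; rewrite ?(ltW u0)// divr_ge0 ?ltW.
  rewrite ler_wpM2l ?powR_ge0// mulr_sumr big_mkcond/=.
  apply: ler_sum => k _; case: ifP => _; last by rewrite !mulr_ge0 ?powR_ge0.
  rewrite mulrCA ler_wpM2l ?powR_ge0//= -powRrM tk powRM ?powR_ge0 ?(ltW (rk0 _))//.
  rewrite mulrC ler_pM ?powR_ge0//.
    rewrite -powRrM; apply: eq_ler; congr (_ `^ _).
    by rewrite /e; field; rewrite !gt_eqF.
  apply: eq_ler; congr (_ `^ _).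
  by rewrite /e; field; rewrite !gt_eqF.
set T := \sum_k _ => H.
have -> : S `^ q = 2 `^ u * S `^ (q - u) * (S / 2) `^ u.
  rewrite (@powR_expR S)// (@powR_expR S)// !powR_expR ?divr_gt0//.
  rewrite -!expRD; congr expR; rewrite lnM ?posrE ?invr_gt0// lnV ?posrE//; ring.
apply: (le_trans (ler_wpM2l _ H)); first by rewrite mulr_ge0 ?powR_ge0.
apply: eq_ler.
rewrite [(sg * S) `^ _]powRM ?ltW// [S `^ (- _)]powRN.
by field; rewrite gt_eqF ?powR_gt0.
Qed.

(** One of the two factors is always one, and the other decays geometrically
away from the scale [d]. *)
Lemma sum_dyadic_max e f : 0 < e -> 0 < f -> exists2 K : R, 0 < K &
  forall d eps n, 0 < d -> 0 < eps ->
    \sum_(k < n) (eps * 2 ^+ k / Num.max (eps * 2 ^+ k) d) `^ e *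
      (d / Num.max (eps * 2 ^+ k) d) `^ f <= K.
Proof.
move=> e0 f0.
have [K1 K10 HK1] := sum_dyadic_le1 e0.
have [K2 K20 HK2] := sum_dyadic_ge1 f0.
exists (K1 + K2) => [|d eps n d0 eps0]; first exact: addr_gt0.
have t0 : 0 < eps / d by rewrite divr_gt0.
apply: le_trans (lerD (HK1 _ n t0) (HK2 _ n t0)).
rewrite [X in _ <= X + _]big_mkcond [X in _ <= _ + X]big_mkcond -big_split/=.
apply: ler_sum => k _; set r := eps * 2 ^+ k.
have r0 : 0 < r by rewrite mulr_gt0// exprn_gt0.
have -> : eps / d * 2 ^+ k = r / d by rewrite /r mulrAC.
have [rd|rd] := leP r d.
  rewrite divff ?gt_eqF// powR1 mulr1 ler_pdivrMr// mul1r rd lerDl.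
  by case: ifP => // _; rewrite powR_ge0.
rewrite divff ?gt_eqF// powR1 mul1r ler_pdivlMr// mul1r (ltW rd).
rewrite ler_pdivrMr// mul1r (lt_geF rd) add0r.
rewrite -[d / r]invf_div -powR_inv1 ?divr_ge0 ?(ltW r0) ?(ltW d0)// -powRrM.
by rewrite mulN1r.
Qed.

End real_sums.

(** * Balls, separability and Tonelli's theorem *)

Lemma measurable_fun_inv {R : realType} d (T : measurableType d) (h : T -> R) :
  measurable_fun setT h -> (forall x, 0 <= h x) ->
  measurable_fun setT (fun x => (h x)^-1).
Proof.
move=> mh h0; have -> : (fun x => (h x)^-1) = (fun x => h x `^ (-1)).
  by apply/funext => x; rewrite powR_inv1.
exact: (measurableT_comp (measurable_powR _)).
Qed.

Section hardy_sobolev.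
Context {R : realType} {X : pmetricType R}.
Variable mu : {measure set (borelType X) -> \bar R}.
Implicit Types (x y z : X) (r t e a : R) (h u v G H : X -> R).
Notation "'rad[' eps ',' k ]" := (eps * 2 ^+ k : R)
  (at level 0, format "'rad[' eps ',' k ]").

Lemma in_ball x r y : ball x r y = (mdist x y < r) :> Prop.
Proof. by rewrite ballEmdist. Qed.

Lemma ball_subset x y r s : mdist x y + r <= s -> ball y r `<=` ball x s.
Proof.
move=> h z; rewrite !in_ball => yz; have := metric_triangle x y z; lra.
Qed.

Lemma open_ballm x r : open (ball x r).
Proof.
rewrite openE => y; rewrite in_ball => xy.
apply/nbhs_ballP; exists (r - mdist x y); first by rewrite /= subr_gt0.
by apply: ball_subset; lra.
Qed.

Lemma open_borel (A : set X) : open A -> measurable (A : set (borelType X)).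
Proof. by move=> oA; apply: sub_sigma_algebra. Qed.

Lemma measurable_ballm x r : measurable (ball x r : set (borelType X)).
Proof. by apply: open_borel; apply: open_ballm. Qed.
Hint Resolve measurable_ballm : core.

Lemma ball_nat_cover x : \bigcup_n ball x n.+1%:R = [set: X].
Proof.
apply/seteqP; split=> // y _; exists (Num.truncn (mdist x y)) => //.
by rewrite in_ball truncnS_gt.
Qed.

Hypothesis Hb : balls_positive_finite mu.

Definition vol x r : R := fine (mu (ball x r)).

Lemma volE x r : 0 < r -> mu (ball x r) = (vol x r)%:E.
Proof.
by move=> r0; rewrite fineK// ge0_fin_numE//; case/andP: (Hb x r0).
Qed.

Lemma vol_gt0 x r : 0 < r -> 0 < vol x r.
Proof. by move=> r0; rewrite -lte_fin -volE//; case/andP: (Hb x r0). Qed.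

Lemma le_vol x y r s : 0 < r -> mdist x y + r <= s -> vol y r <= vol x s.
Proof.
move=> r0 h; have s0 : 0 < s by have := mdist_ge0 x y; lra.
rewrite -lee_fin -!volE//; apply: le_measure; rewrite ?inE//.
exact: ball_subset.
Qed.

Lemma sigma_finite_balls : sigma_finite [set: borelType X] mu.
Proof.
exists (fun n => ball (point : X) n.+1%:R); first by rewrite ball_nat_cover.
by move=> n; split=> //; case/andP: (@Hb point n.+1%:R (ltr0Sn _ _)).
Qed.

(** The measure [mu] again, under a name to which its sigma-finiteness can be
attached. *)
Definition sigma_finite_mu : set (borelType X) -> \bar R := mu.
HB.instance Definition _ := Measure.copy sigma_finite_mu mu.
HB.instance Definition _ :=
  Measure_isSigmaFinite.Build _ _ _ sigma_finite_mu sigma_finite_balls.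

Variables (Q c : R).
Hypothesis c0 : 0 < c.
Hypothesis Hmass : forall x r, 0 < r -> ((c * r `^ Q)%:E <= mu (ball x r))%E.

Lemma vol_ge x r : 0 < r -> c * r `^ Q <= vol x r.
Proof. by move=> r0; rewrite -lee_fin -volE//; apply: Hmass. Qed.

(** Otherwise a ball would contain arbitrarily many disjoint balls of one
radius, each of which has at least a fixed mass. *)
Lemma ball_finite_net x r e : 0 < e ->
  exists s : seq X, forall y, ball x r y -> exists2 z, z \in s & mdist z y < e.
Proof.
move=> e0; apply: contrapT => /forallNP H.
have {}H (s : seq X) : exists2 y, ball x r y & forall z, z \in s -> e <= mdist z y.
  have /existsNP[y /not_implyP[xy /forall2NP h]] := H s.
  exists y => // z zs; have [//|/negP] := h z.
  by rewrite -leNgt.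
have e20 : 0 < e / 2 by rewrite divr_gt0.
pose m := c * (e / 2) `^ Q.
have m0 : 0 < m by rewrite mulr_gt0// powR_gt0.
have Hn n : exists (s : seq X) (U : set (borelType X)),
   [/\ measurable U, U `<=` ball x (r + e),
     U `<=` \bigcup_(z in [set` s]) ball z (e / 2) & ((m *+ n)%:E <= mu U)%E].
  elim: n => [|n [s [U [mU Ur Us mn]]]].
    by exists [::], set0; split; rewrite ?measure0.
  have [y xy hy] := H s.
  exists (y :: s), (U `|` ball y (e / 2)); split.
  - exact: measurableU.
  - move=> z [/Ur//|]; apply: ball_subset; move: xy; rewrite in_ball; lra.
  - move=> z [/Us[w ws zw]|yz]; last by exists y; rewrite //= mem_head.
    by exists w => //=; rewrite inE; apply/orP; right; exact: ws.
  - have mm : (m%:E <= mu (ball y (e / 2)))%E by apply: Hmass.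
    rewrite measureU//; first by rewrite mulrSr EFinD leeD.
    apply/seteqP; split=> // z [/Us[w ws]].
    rewrite !in_ball => wz yz; have := hy w ws.
    have := metric_triangle w z y; rewrite (metric_sym z y); lra.
have [re|re] := leP (r + e) 0.
  have [y + _] := H [::]; rewrite in_ball; have := mdist_ge0 x y; lra.
have [n /andP[_ nh]] : exists n, (0 <= n)%N && (vol x (r + e) < m *+ n).
  exists (Num.truncn (vol x (r + e) / m)).+1.
  by rewrite -mulr_natl -ltr_pdivrMr// truncnS_gt.
have [s [U [mU Ur _ mn]]] := Hn n.
have : ((m *+ n)%:E <= (vol x (r + e))%:E)%E.
  by apply: (le_trans mn); rewrite -volE//; apply: le_measure; rewrite ?inE.
by rewrite lee_fin leNgt nh.
Qed.

(** The Borel sets of [X * X] may be larger than the product sigma-algebra, so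
this needs separability: by [ball_finite_net] the set is a countable union of
products of balls. *)
Lemma measurable_mdist_lt r :
  measurable ([set z | mdist z.1 z.2 < r] : set (borelType X * borelType X)).
Proof.
have net N j : {s : seq X | forall y, ball (point : X) N.+1%:R y ->
    exists2 z, z \in s & mdist z y < (j.+1%:R)^-1 :> R}.
  by apply: cid; apply: ball_finite_net; rewrite invr_gt0.
pose S N j := projT1 (net N j).
pose z N j i := nth point (S N j) i.
have -> : [set w : X * X | mdist w.1 w.2 < r] =
  \bigcup_N \bigcup_j \bigcup_i (ball (z N j i) (j.+1%:R)^-1 `*`
    ball (z N j i) (r - (j.+1%:R)^-1)).
  apply/seteqP; split=> [[x y]/= xy|[x y]/= [N _ [j _ [i _]]]]; last first.
    rewrite /= !in_ball => -[h1 h2].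
    have := metric_triangle x (z N j i) y; rewrite (metric_sym x (z N j i)).
    by move: (_^-1) h1 h2 => d h1 h2; lra.
  have [N _ Nx] : (\bigcup_n ball (point : X) n.+1%:R) x.
    by rewrite ball_nat_cover.
  pose j := Num.truncn (2 / (r - mdist x y)).
  have jh : 2 * (j.+1%:R)^-1 < r - mdist x y.
    rewrite ltr_pdivrMr// mulrC -ltr_pdivrMr ?subr_gt0//.
    exact: truncnS_gt.
  exists N => //; exists j => //.
  have [w wS wx] := projT2 (net N j) _ Nx.
  exists (index w (S N j)) => //=; rewrite /z nth_index// !in_ball; split=> //.
  have := metric_triangle w x y.
  by move: (_^-1) jh wx => d jh wx; lra.
apply: bigcupT_measurable => N; apply: bigcupT_measurable => j.
by apply: bigcupT_measurable => i; apply: measurableX.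
Qed.

Lemma tonelli (f : borelType X * borelType X -> \bar R) :
  measurable_fun setT f -> (forall w, 0 <= f w)%E ->
  (\int[mu]_x \int[mu]_y f (x, y) = \int[mu]_y \int[mu]_x f (x, y))%E.
Proof.
move=> mf f0.
pose m : {sigma_finite_measure set (borelType X) -> \bar R} := sigma_finite_mu.
have := @fubini_tonelli1 _ _ _ _ _ m m f mf f0.
rewrite (@fubini_tonelli2 _ _ _ _ _ m m f mf f0) => /esym.
exact.
Qed.

Variable CD : R.
Hypothesis CD0 : 0 < CD.
Hypothesis Hdbl : forall x r, 0 < r ->
  (mu (ball x (2 * r)) <= CD%:E * mu (ball x r))%E.

Lemma vol_double x r : 0 < r -> vol x (2 * r) <= CD * vol x r.
Proof.
by move=> r0; rewrite -lee_fin EFinM -!volE ?mulr_gt0//; apply: Hdbl.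
Qed.

Lemma vol_near x y r : 0 < r -> mdist x y <= r -> vol y r <= CD * vol x r.
Proof.
move=> r0 xy; apply: le_trans (vol_double _ r0).
by apply: le_vol => //; lra.
Qed.

Lemma measurable_vol r : 0 < r ->
  measurable_fun setT (fun x : borelType X => vol x r).
Proof.
move=> r0; pose m : {sigma_finite_measure set (borelType X) -> \bar R} :=
  sigma_finite_mu.
have := measurable_fun_xsection m (measurable_mdist_lt r).
have -> : m \o xsection [set z : X * X | mdist z.1 z.2 < r] =
    fun x => (vol x r)%:E.
  apply/funext => x; rewrite -volE//=; congr (mu _).
  by apply/seteqP; split=> y; rewrite in_ball /xsection/= inE.
by move/measurable_EFinP.
Qed.

Definition avg r (H : X -> R) x : R :=
  fine (\int[mu]_(y in ball x r) (H y)%:E)%E / vol x r.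

Lemma avg_ge0 r H x : 0 < r -> (forall y, 0 <= H y) -> 0 <= avg r H x.
Proof.
move=> r0 H0; rewrite divr_ge0 ?(ltW (vol_gt0 _ r0))// fine_ge0//.
by apply: integral_ge0 => y _; rewrite lee_fin.
Qed.

(** It is the measurability of a partial integral over the set of all [(x, y)]
with [mdist x y < r]. *)
Lemma measurable_avg r (H : X -> R) : 0 < r ->
  measurable_fun setT (H : borelType X -> R) -> (forall x, 0 <= H x) ->
  measurable_fun setT (avg r H : borelType X -> R).
Proof.
move=> r0 mH H0; apply: measurable_funM; last first.
  apply: measurable_fun_inv; first exact: measurable_vol.
  by move=> x; rewrite ltW// vol_gt0.
apply: (@measurableT_comp _ _ _ _ _ _ (@fine R)) => //.
pose A : set (borelType X * borelType X) := [set z | mdist z.1 z.2 < r].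
pose k (w : borelType X * borelType X) : \bar R := (\1_A w * H w.2)%:E.
have mk : measurable_fun setT k.
  apply/measurable_EFinP; apply: measurable_funM; last exact: measurableT_comp.
  by apply: measurable_indic; apply: measurable_mdist_lt.
have k0 w : (0 <= k w)%E by rewrite lee_fin mulr_ge0.
have := measurable_fun_fubini_tonelli_F (m2 := sigma_finite_mu) k mk k0.
congr measurable_fun; apply/funext => x; rewrite /fubini_F [RHS]integral_mkcond.
apply: eq_integral => y _; rewrite /k /patch indicE.
rewrite (_ : ((x, y) \in A) = (y \in (ball x r : set (borelType X)))); last first.
  by apply/idP/idP; rewrite !inE in_ball.
by case: ifP => _; rewrite ?mul1r ?mul0r.
Qed.

(** The kernel of the mean over [B(x, r)] is [1/mu(B(x, r))] for
[mdist x y < r]. By doubling it is at most [CD] times its transpose, so by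
Tonelli's theorem the operator is at most [CD] times its adjoint. *)
Lemma avg_swap r (H phi psi : X -> R) : 0 < r ->
  measurable_fun setT (H : borelType X -> R) -> (forall x, 0 <= H x) ->
  measurable_fun setT (phi : borelType X -> R) -> (forall x, 0 <= phi x) ->
  measurable_fun setT (psi : borelType X -> R) -> (forall x, 0 <= psi x) ->
  (forall y, (\int[mu]_(x in ball y r) (phi x)%:E <= (psi y * vol y r)%:E)%E) ->
  (\int[mu]_x (phi x * avg r H x)%:E <= \int[mu]_y (CD * (H y * psi y))%:E)%E.
Proof.
move=> r0 mH H0 mphi phi0 mpsi psi0 Hpsi.
pose A : set (borelType X * borelType X) := [set z | mdist z.1 z.2 < r].
pose k (w : borelType X * borelType X) : \bar R :=
  (\1_A w * (phi w.1 / vol w.1 r * H w.2))%:E.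
have mk : measurable_fun setT k.
  apply/measurable_EFinP; apply: measurable_funM.
    by apply: measurable_indic; apply: measurable_mdist_lt.
  apply: measurable_funM; last exact: measurableT_comp.
  apply: (@measurableT_comp _ _ _ _ _ _ (fun x : borelType X => phi x / vol x r))
    => //.
  apply: measurable_funM => //.
  apply: measurable_fun_inv; first exact: measurable_vol.
  by move=> x; rewrite ltW// vol_gt0.
have iv0 x : 0 <= (vol x r)^-1 by rewrite invr_ge0 ltW ?vol_gt0.
have k0 w : (0 <= k w)%E.
  by rewrite lee_fin !mulr_ge0 ?indic_ge0.
have kx x : (\int[mu]_y k (x, y) =
    (phi x / vol x r)%:E * \int[mu]_(y in ball x r) (H y)%:E)%E.
  rewrite -ge0_integralZl//; last 3 first.
  - by apply: measurable_funTS; apply/measurable_EFinP.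
  - by move=> y _; rewrite lee_fin.
  - by rewrite lee_fin mulr_ge0.
  rewrite [RHS]integral_mkcond; apply: eq_integral => y _; rewrite /k /patch indicE.
  rewrite (_ : ((x, y) \in A) = (y \in (ball x r : set (borelType X)))); last first.
    by apply/idP/idP; rewrite !inE in_ball.
  by case: ifP => _; rewrite ?mul1r ?mul0r ?mule0// EFinM.
have ky y : (\int[mu]_x k (x, y) <= (CD * (H y * psi y))%:E)%E.
  apply: (@le_trans _ _ (\int[mu]_(x in ball y r)
      ((H y * CD / vol y r)%:E * (phi x)%:E))%E).
    rewrite [leRHS]integral_mkcond; apply: ge0_le_integral => //.
    - exact: (@measurable_fun_pair1 _ _ _ (borelType X) (borelType X) _ k y mk).
    - apply/(measurable_restrictT _ _).1 => //.
      apply: measurable_funTS; apply/measurable_EFinP.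
      exact: measurable_funM.
    - move=> x _; rewrite /k /patch indicE.
      rewrite (_ : ((x, y) \in A) = (x \in (ball y r : set (borelType X)))); last first.
        by apply/idP/idP; rewrite !inE in_ball /A/= metric_sym.
      case: ifPn => [|_]; last by rewrite mul0r.
      rewrite inE in_ball => yx; rewrite mul1r -EFinM lee_fin/=.
      rewrite [leLHS](_ : _ = H y * phi x * (vol x r)^-1); last by ring.
      rewrite [leRHS](_ : _ = H y * phi x * (CD / vol y r)); last by ring.
      rewrite ler_wpM2l ?mulr_ge0// ler_pdivlMr ?vol_gt0// mulrC.
      rewrite ler_pdivrMr ?vol_gt0//.
      by apply: vol_near; rewrite // metric_sym ltW.
  rewrite ge0_integralZl//; last 3 first.
  - by apply: measurable_funTS; apply/measurable_EFinP.
  - by move=> x _; rewrite lee_fin.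
  - by rewrite lee_fin !mulr_ge0// ltW.
  apply: le_trans (lee_wpmul2l _ (Hpsi y)) _.
    by rewrite lee_fin !mulr_ge0// ltW.
  rewrite -EFinM lee_fin; apply: eq_ler; field.
  by rewrite gt_eqF ?vol_gt0.
apply: (@le_trans _ _ (\int[mu]_x \int[mu]_y k (x, y))%E); last first.
  rewrite tonelli//; apply: ge0_le_integral => //.
  - by move=> y _; apply: integral_ge0.
  - exact: (measurable_fun_fubini_tonelli_G (m1 := sigma_finite_mu)).
  - apply/measurable_EFinP; apply: measurable_funM => //.
    exact: measurable_funM.
apply: ge0_le_integral => //.
- by move=> x _; rewrite lee_fin !mulr_ge0// fine_ge0// integral_ge0// => y _;
    rewrite lee_fin.
- apply/measurable_EFinP; apply: measurable_funM => //.
  exact: measurable_avg.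
- exact: (measurable_fun_fubini_tonelli_F (m2 := sigma_finite_mu)).
- move=> x _; rewrite kx /avg.
  rewrite [X in X%:E](_ : _ = phi x / vol x r *
    fine (\int[mu]_(y in ball x r) (H y)%:E)%E); last by ring.
  have I0 : (0 <= \int[mu]_(y in ball x r) (H y)%:E)%E.
    by apply: integral_ge0 => y _; rewrite lee_fin.
  rewrite EFinM lee_wpmul2l ?lee_fin ?mulr_ge0//.
  by case: (\int[mu]_(y in _) _)%E I0 => //= *; rewrite leey.
Qed.

(** * Powers of the distance to a set *)

Variable E : set X.
Hypothesis E0 : E !=set0.

Notation d := (dist_set E).

Lemma has_lbound_dist x : has_lbound [set mdist x y | y in E].
Proof. by exists 0 => _ [y _ <-]; apply: mdist_ge0. Qed.

Lemma dist_set_le x y : E y -> d x <= mdist x y.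
Proof. by move=> Ey; apply: ge_inf; [apply: has_lbound_dist|exists y]. Qed.

Lemma dist_set_ge0 x : 0 <= d x.
Proof.
case: E0 => y Ey; apply: lb_le_inf; first by exists (mdist x y), y.
by move=> _ [z _ <-]; apply: mdist_ge0.
Qed.

Lemma dist_set_lt x r : d x < r -> exists2 z, E z & mdist x z < r.
Proof.
move=> dr; case: E0 => y Ey.
have h : has_inf [set mdist x y | y in E].
  by split; [exists (mdist x y), y | apply: has_lbound_dist].
have [_ [z Ez <-]] := @inf_adherent _ _ (r - d x) ltac:(by rewrite subr_gt0) h.
by rewrite /d subrKC => ?; exists z.
Qed.

Lemma dist_set_triangle x y : d x <= mdist x y + d y.
Proof.
apply/ler_addgt0Pl => e e0.
have [z Ez yz] := @dist_set_lt y (d y + e) ltac:(lra).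
have := dist_set_le x Ez; have := metric_triangle x y z; lra.
Qed.

Lemma dist_set_ball x r y : ball x r y -> d x - r < d y < d x + r.
Proof.
rewrite in_ball => xy; have := dist_set_triangle x y.
have := dist_set_triangle y x; rewrite (metric_sym y x); lra.
Qed.

Lemma lipschitz_measurable L (f : X -> R) :
  (forall x y, `|f x - f y| <= L * mdist x y) ->
  measurable_fun setT (f : borelType X -> R).
Proof.
move=> Lf; apply: (measurability _ (RGenOInfty.measurableE R)) => //.
move=> _ [_ [a ->] <-]; rewrite setTI; apply: open_borel.
rewrite openE => x /=; rewrite in_itv/= andbT => ax.
have L1 : 0 < `|L| + 1 by have := normr_ge0 L; lra.
apply/nbhs_ballP; exists ((f x - a) / (`|L| + 1)) => /=.
  by rewrite divr_gt0 ?subr_gt0.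
move=> y; rewrite in_ball /= in_itv/= andbT.
rewrite ltr_pdivlMr// => xy.
have := Lf x y; have := ler_norm (f x - f y).
have := ler_norm L; have := mdist_ge0 x y; nra.
Qed.

Lemma measurable_dist_set : measurable_fun setT (d : borelType X -> R).
Proof.
apply: (@lipschitz_measurable 1) => x y.
have := dist_set_triangle x y; have := dist_set_triangle y x.
rewrite (metric_sym y x) ler_norml; lra.
Qed.

Hint Resolve dist_set_ge0 measurable_dist_set : core.

Lemma measurable_dist_powR a :
  measurable_fun setT (fun x : borelType X => d x `^ a).
Proof. exact: measurableT_comp (measurable_powR _) measurable_dist_set. Qed.

Lemma measurable_dist_eq0 : measurable ([set x | d x = 0] : set (borelType X)).
Proof.
have -> : [set x | d x = 0] = [set: borelType X] `&` d @^-1` [set 0].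
  by rewrite setTI.
by apply: measurable_dist_set => //; apply: measurable_set1.
Qed.

Lemma measurable_dist_lt r : measurable ([set x | d x < r] : set (borelType X)).
Proof.
have -> : [set x | d x < r] = [set: borelType X] `&` d @^-1` `]-oo, r[%classic.
  by apply/seteqP; split=> x /=; rewrite in_itv/=; [split|case].
by apply: measurable_dist_set => //; apply: measurable_itv.
Qed.

Lemma powR_infty_ge0 (t a : R) : (0 <= powR_infty t a)%E.
Proof.
by rewrite /powR_infty; case: ifP => _; rewrite ?leey// lee_fin powR_ge0.
Qed.

Lemma powR_infty_gt0 (t a : R) : 0 < t -> powR_infty t a = (t `^ a)%:E.
Proof. by move=> t0; rewrite /powR_infty gt_eqF. Qed.

Lemma measurable_weight a :
  measurable_fun setT (fun x : borelType X => powR_infty (d x) a).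
Proof.
rewrite /powR_infty; apply: measurable_fun_ifT.
- apply: measurable_and => //.
  by apply: measurable_fun_eqr => //; apply: measurable_dist_set.
- exact: measurable_cst.
- by apply/measurable_EFinP; apply: measurable_dist_powR.
Qed.

Lemma integral_ball_le_cst x r (h : X -> \bar R) (M : R) : 0 < r -> 0 <= M ->
  measurable_fun setT (h : borelType X -> \bar R) -> (forall y, 0 <= h y)%E ->
  (forall y, ball x r y -> h y <= M%:E)%E ->
  (\int[mu]_(y in ball x r) h y <= (M * vol x r)%:E)%E.
Proof.
move=> r0 M0 mh h0 hM.
rewrite EFinM -volE// -integral_cst//.
apply: ge0_le_integral => //; exact: measurable_funTS.
Qed.

Variables (rho Ca : R).
Hypothesis Ca1 : 1 <= Ca.
Hypothesis Hrho : forall x r t, E x -> 0 < r -> r < t ->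
  (mu (neighborhood E r `&` ball x t) / mu (ball x t)
    <= (Ca * (r / t) `^ rho)%:E)%E.

(** The bound on the codimension at dyadic scales; for [j = 0], which it does
not cover, the right-hand side is at least the measure of the ball. *)
Lemma neighborhood_measure z t (j : nat) : E z -> 0 < t ->
  (mu ([set y | (d y < t / 2 ^+ j)%R] `&` ball z t)
    <= (Ca * (2 ^+ j) `^ (- rho) * vol z t)%:E)%E.
Proof.
move=> Ez t0; have [->|j0] := posnP j.
  rewrite expr0 divr1 powR1 mulr1.
  apply: (@le_trans _ _ (mu (ball z t))).
    apply: le_measure; rewrite ?inE//; apply: measurableI => //.
    exact: measurable_dist_lt.
  by rewrite volE// lee_fin ler_peMl// ltW// vol_gt0.
have j1 : 0 < (2 : R) ^+ j by rewrite exprn_gt0.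
have := @Hrho z (t / 2 ^+ j) t Ez (divr_gt0 t0 j1).
rewrite ltr_pdivrMr// ltr_pMr// exprn_egt1 ?ltr1n -?lt0n// => /(_ j0).
rewrite volE// inver gt_eqF ?vol_gt0// lee_pdivrMr ?vol_gt0// => /le_trans; apply.
rewrite -EFinM lee_fin ler_wpM2r ?(ltW (vol_gt0 _ t0))//.
rewrite (_ : t / 2 ^+ j / t = (2 ^+ j)^-1); last by field; rewrite !gt_eqF.
by rewrite -powR_inv1 ?(ltW j1)// -powRrM mulN1r.
Qed.

(** On the layer [s 2^(-j-1) <= d < s 2^(-j)] the weight [d ^ -a] is at most a
multiple of [(s 2^-j) ^ -a], and the layer occupies at most a multiple of the
fraction [2 ^ (- j rho)] of the ball; the resulting geometric series converges
as [a < rho]. Where [d = 0] the sum of the majorants diverges, as it should: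
there the weight is infinite. *)
Lemma integral_weight_center a : 0 < a -> a < rho ->
  exists2 C : R, 0 < C & forall z s, E z -> 0 < s ->
    (\int[mu]_(y in ball z s) powR_infty (d y) (- a)
      <= (C * s `^ (- a) * vol z s)%:E)%E.
Proof.
move=> a0 arho; have e0 : 0 < rho - a by rewrite subr_gt0.
have [K K0 HK] := sum_dyadic_ge1 e0.
have Ca0 : 0 < Ca := lt_le_trans ltr01 Ca1.
exists (2 `^ a * Ca * K) => [|z s Ez s0].
  by rewrite !mulr_gt0// powR_gt0.
pose t (j : nat) : R := s / 2 ^+ j.
have p2 (j : nat) : 0 < (2 : R) ^+ j by rewrite exprn_gt0.
have t0 (j : nat) : 0 < t j by rewrite divr_gt0.
pose N (j : nat) : set (borelType X) := [set y | d y < t j].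
have mN j : measurable (N j) by apply: measurable_dist_lt.
pose F (j : nat) y : \bar R := (t j.+1 `^ (- a) * \1_(N j) y)%:E.
have F0 j y : (0 <= F j y)%E by rewrite lee_fin mulr_ge0 ?powR_ge0.
have mF j : measurable_fun setT (F j : borelType X -> \bar R).
  by apply/measurable_EFinP; apply: measurable_funM.
apply: (@le_trans _ _ (\int[mu]_(y in ball z s) (\sum_(j <oo) F j y))%E).
  apply: ge0_le_integral => //.
  - by move=> y _; apply: powR_infty_ge0.
  - by apply: measurable_funTS; apply: measurable_weight.
  - apply: measurable_funTS; apply: ge0_emeasurable_sum => //.
  move=> y; rewrite in_ball => zy.
  have dys : d y < s.
    by apply: le_lt_trans (dist_set_le y Ez) _; rewrite metric_sym.
  have [dy0|dy0] := eqVneq (d y) 0.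
    suff -> : (\sum_(j <oo) F j y = +oo)%E by rewrite leey.
    apply/eqyP => A A0; pose n := (Num.truncn (A / s `^ (- a))).+1.
    apply: le_trans (nneseries_lim_ge n _); last by move=> j _ _; apply: F0.
    apply: (@le_trans _ _ (\sum_(0 <= j < n) (s `^ (- a))%:E)%E); last first.
      apply: lee_sum => j _; rewrite lee_fin indicE mem_set ?mulr1.
        apply: powR_leN; rewrite ?oppr_le0 ?(ltW a0)//.
        by rewrite ler_pdivrMr// ler_peMr ?(ltW s0)// exprn_ege1 ?ler1n.
      by rewrite /N/= dy0.
    rewrite sumEFin lee_fin sumr_const_nat subn0 -mulr_natl.
    by rewrite -ler_pdivrMr ?powR_gt0// ltW// truncnS_gt.
  have {}dy0 : 0 < d y by rewrite lt0r dy0 dist_set_ge0.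
  have ex : exists j, t j.+1 <= d y.
    exists (Num.truncn (s / d y)); rewrite ler_pdivrMr// mulrC -ler_pdivrMr//.
    apply: ltW; apply: lt_le_trans (truncnS_gt _) _.
    by rewrite -natrX ler_nat ltnW// ltn_expl.
  pose j := ex_minn ex.
  have [tj Nj] : t j.+1 <= d y /\ N j y.
    rewrite /j; case: ex_minnP => i ti mi; split=> //.
    rewrite /N/= ltNge; apply/negP => h; case: i ti mi h => [|i] ti mi h.
      by move: h; rewrite /t expr0 divr1; apply/negP; rewrite -ltNge.
    by have := mi i h; rewrite ltnn.
  apply: (@le_trans _ _ (F j y)).
    rewrite powR_infty_gt0// lee_fin indicE mem_set// mulr1.
    by apply: powR_leN => //; rewrite oppr_le0 ltW.
  apply: le_trans (nneseries_lim_ge j.+1 _); last by move=> i _ _; apply: F0.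
  by rewrite big_nat_recr//= leeDr// sume_ge0.
rewrite integral_nneseries//; last first.
  by move=> j; apply: (@measurable_funTS _ _ (borelType X) _ _ (F j)).
apply: lime_le.
  by apply: is_cvg_nneseries => j _ _; apply: integral_ge0.
near=> n.
have e j : (\int[mu]_(y in ball z s) F j y <=
    (2 `^ a * Ca * s `^ (- a) * vol z s * (1 * 2 ^+ j) `^ (- (rho - a)))%:E)%E.
  under eq_integral do rewrite /F EFinM.
  rewrite ge0_integralZl//; last 2 first.
  - by apply: measurable_funTS; apply/measurable_EFinP.
  - by rewrite lee_fin powR_ge0.
  rewrite integral_indic//.
  apply: le_trans (lee_wpmul2l _ (neighborhood_measure j Ez s0)) _.
    by rewrite lee_fin powR_ge0.
  rewrite -EFinM lee_fin mul1r; apply: eq_ler.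
  rewrite /t exprS (@powR_expR _ (s / _)) ?divr_gt0 ?mulr_gt0//.
  rewrite !powR_expR// !lnM ?posrE ?invr_gt0 ?mulr_gt0// lnV ?posrE ?mulr_gt0//.
  rewrite lnM ?posrE//.
  set u := ln 2; set v := ln (2 ^+ j); set w := ln s.
  rewrite [LHS](_ : _ = Ca * vol z s * (expR (- a * (w - (u + v))) *
    expR (- rho * v))); last by ring.
  rewrite [RHS](_ : _ = Ca * vol z s * (expR (a * u) * expR (- a * w) *
    expR (- (rho - a) * v))); last by ring.
  by rewrite -!expRD; congr (_ * expR _); ring.
apply: le_trans (lee_sum _ (fun j _ => e j)) _.
rewrite sumEFin lee_fin big_mkord -mulr_sumr.
rewrite [leRHS](_ : _ = 2 `^ a * Ca * s `^ (- a) * vol z s * K); last by ring.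
rewrite ler_wpM2l//; first by rewrite !mulr_ge0 ?powR_ge0 ?ltW// vol_gt0.
apply: le_trans (HK 1 n ltr01); rewrite [leRHS]big_mkcond/=.
apply: ler_sum => j _; rewrite mul1r.
by rewrite exprn_ege1// ler1n.
Unshelve. all: by end_near. Qed.

(** If [r <= d x / 2], the weight is almost constant on the ball. Otherwise the
ball is contained in one of radius [3 r] around a point of [E]. *)
Lemma integral_weight a : a < rho -> exists2 C : R, 0 < C &
  forall x r, 0 < r -> (\int[mu]_(y in ball x r) powR_infty (d y) (- a)
    <= (C * Num.max r (d x) `^ (- a) * vol x r)%:E)%E.
Proof.
move=> arho.
pose m r x := Num.max r (d x).
have far (M : R) x r : 0 < r -> 0 <= M ->
    (forall y, ball x r y -> powR_infty (d y) (- a) <= M%:E)%E ->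
    (\int[mu]_(y in ball x r) powR_infty (d y) (- a) <= (M * vol x r)%:E)%E.
  move=> r0 M0 h; apply: integral_ball_le_cst => //.
    exact: measurable_weight.
  by move=> y; apply: powR_infty_ge0.
have m0 r x : 0 < r -> 0 < m r x by move=> r0; rewrite /m lt_max r0.
have [a0|a0] := leP a 0.
  exists (2 `^ (- a)) => [|x r r0]; first exact: powR_gt0.
  rewrite -powRM// ?(ltW (m0 r x r0))//; apply: far; rewrite ?powR_ge0// => y xy.
  rewrite /powR_infty ltNge oppr_ge0 a0 andbF lee_fin powR_le ?dist_set_ge0 ?oppr_ge0//.
  have := dist_set_ball xy; rewrite /m.
  have : r <= Num.max r (d x) by rewrite le_max lexx.
  have : d x <= Num.max r (d x) by rewrite le_max lexx orbT.
  lra.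
have [C C0 HC] := integral_weight_center a0 arho.
exists (2 `^ a + C * CD ^+ 3 * 2 `^ a) => [|x r r0].
  by rewrite addr_gt0// ?mulr_gt0// ?exprn_gt0// powR_gt0.
have [rd|rd] := leP r (d x / 2).
  have -> : Num.max r (d x) = d x by apply/max_idPr; lra.
  have dx0 : 0 < d x by lra.
  apply: (@le_trans _ _ (((d x / 2) `^ (- a)) * vol x r)%:E).
    apply: far => //; first exact: powR_ge0.
    move=> y /dist_set_ball xy; rewrite powR_infty_gt0; last lra.
    by rewrite lee_fin; apply: powR_leN; lra.
  rewrite lee_fin ler_wpM2r ?(ltW (vol_gt0 _ r0))//.
  rewrite powRM ?(ltW dx0)// -[2^-1]powR_inv1// -powRrM mulrN mulN1r opprK.
  rewrite mulrC ler_wpM2r ?powR_ge0// lerDl.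
  by rewrite !mulr_ge0 ?exprn_ge0 ?powR_ge0 ?ltW.
have [z Ez xz] := @dist_set_lt x (2 * r) ltac:(lra).
have r30 : 0 < 3 * r by lra.
apply: (@le_trans _ _ (\int[mu]_(y in ball z (3 * r)) powR_infty (d y) (- a))%E).
  apply: ge0_subset_integral => //.
  - by apply: measurable_funTS; apply: measurable_weight.
  - by move=> y _; apply: powR_infty_ge0.
  - by apply: ball_subset; rewrite metric_sym; lra.
apply: le_trans (HC z _ Ez r30) _; rewrite lee_fin.
(* B(z, 3 r) lies in B(x, 8 r), which takes three doublings *)
have V : vol z (3 * r) <= CD ^+ 3 * vol x r.
  apply: (@le_trans _ _ (vol x (2 * (2 * (2 * r))))); first by apply: le_vol; lra.
  rewrite !exprS expr0 mulr1 -!mulrA.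
  have v1 := @vol_double x (2 * (2 * r)) ltac:(lra).
  have v2 := @vol_double x (2 * r) ltac:(lra).
  have v3 := @vol_double x r r0.
  by apply: (le_trans v1); rewrite ler_pM2l//; apply: (le_trans v2);
    rewrite ler_pM2l.
have P : (3 * r) `^ (- a) <= 2 `^ a * Num.max r (d x) `^ (- a).
  have -> : 2 `^ a = (2^-1 : R) `^ (- a).
    by rewrite -[2^-1]powR_inv1// -powRrM mulN1r opprK.
  rewrite -powRM; last 2 first.
  - by rewrite invr_ge0.
  - by rewrite ltW// m0.
  apply: powR_leN; rewrite ?oppr_le0 ?(ltW a0) ?mulr_gt0 ?m0//.
  rewrite maxEle; case: ifP => _; lra.
apply: (@le_trans _ _ (C * CD ^+ 3 * 2 `^ a * Num.max r (d x) `^ (- a) * vol x r)).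
  rewrite [leRHS](_ : _ = C * (2 `^ a * Num.max r (d x) `^ (- a)) *
    (CD ^+ 3 * vol x r)); last by ring.
  apply: ler_pM => //; first by rewrite mulr_ge0 ?powR_ge0 ?ltW.
  - by rewrite ltW// vol_gt0.
  - by rewrite ler_pM2l.
rewrite ler_wpM2r ?(ltW (vol_gt0 _ r0))// ler_wpM2r ?powR_ge0//.
by rewrite lerDr powR_ge0.
Qed.

Lemma integral_dist_powR a : - rho < a -> exists2 C : R, 0 < C &
  forall x r, 0 < r -> (\int[mu]_(y in ball x r) (d y `^ a)%:E
    <= (C * Num.max r (d x) `^ a * vol x r)%:E)%E.
Proof.
move=> arho; have arho' : - a < rho by lra.
have [C C0 HC] := integral_weight arho'; rewrite opprK in HC.
exists C => // x r r0; apply: le_trans (HC x r r0).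
apply: ge0_le_integral => //.
- by move=> y _; rewrite lee_fin powR_ge0.
- by apply: measurable_funTS; apply/measurable_EFinP; apply: measurable_dist_powR.
- by apply: measurable_funTS; apply: measurable_weight.
- by move=> y _; rewrite /powR_infty; case: ifP => _; rewrite ?leey.
Qed.

(** A weight that is infinite on a set has a finite integral over every ball. *)
Lemma dist_eq0_null : 0 < rho -> mu [set x | d x = 0] = 0%E.
Proof.
move=> rho1; apply/eqP; rewrite eq_le measure_ge0 andbT.
have [C C0 HC] := @integral_weight (rho / 2) ltac:(lra).
pose Z : set (borelType X) := [set x | d x = 0].
have mZ : measurable Z by apply: measurable_dist_eq0.
have ZB n : mu (Z `&` ball (point : X) n.+1%:R) = 0%E.
  apply/eqP; rewrite eq_le measure_ge0 andbT leNgt; apply/negP => Z0.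
  have := HC point n.+1%:R ltac:(by rewrite ltr0n).
  apply/negP; rewrite -ltNge.
  apply: (@lt_le_trans _ _ +oo%E); first exact: ltry.
  apply: (@le_trans _ _
    (\int[mu]_(y in Z `&` ball (point : X) n.+1%:R) (cst +oo y))%E).
    by rewrite integral_cst//; [rewrite gt0_mulye|apply: measurableI].
  apply: (@le_trans _ _ (\int[mu]_(y in Z `&` ball (point : X) n.+1%:R)
      powR_infty (d y) (- (rho / 2)))%E).
    apply: ge0_le_integral => //.
    - exact: measurableI.
    - by move=> y _; rewrite leey.
    - by apply: measurable_funTS; apply: measurable_weight.
    - move=> y [Zy _]; rewrite /powR_infty Zy eqxx/= ifT//; lra.
  apply: ge0_subset_integral => //.
  - exact: measurableI.
  - by apply: measurable_funTS; apply: measurable_weight.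
  - by move=> y _; apply: powR_infty_ge0.
have -> : [set x | d x = 0] = \bigcup_n (Z `&` ball (point : X) n.+1%:R).
  by rewrite -setI_bigcupr ball_nat_cover setIT.
have mZB n : measurable (Z `&` ball (point : X) n.+1%:R) by apply: measurableI.
set F := fun n => Z `&` ball (point : X) n.+1%:R.
have : (mu (\bigcup_n F n) <= \sum_(n <oo) mu (F n))%E.
  by apply: measure_sigma_subadditive => //; apply: bigcupT_measurable.
by move=> /le_trans; apply; rewrite eseries0// => n _ _; apply: ZB.
Qed.

(** * Means over balls *)

Lemma avg_le r h x (M : R) : 0 < r -> (forall y, 0 <= h y) ->
  (\int[mu]_(y in ball x r) (h y)%:E <= (M * vol x r)%:E)%E -> avg r h x <= M.
Proof.
move=> r0 h0 hM; rewrite ler_pdivrMr ?vol_gt0//.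
have I0 : (0 <= \int[mu]_(y in ball x r) (h y)%:E)%E.
  by apply: integral_ge0 => y _; rewrite lee_fin.
rewrite -lee_fin fineK// ge0_fin_numE//; apply: le_lt_trans hM _.
exact: ltry.
Qed.

Lemma integral_avg r h x : 0 < r -> (forall y, 0 <= h y) ->
  (\int[mu]_(y in ball x r) (h y)%:E < +oo)%E ->
  (\int[mu]_(y in ball x r) (h y)%:E = (avg r h x * vol x r)%:E)%E.
Proof.
move=> r0 h0 hM.
have I0 : (0 <= \int[mu]_(y in ball x r) (h y)%:E)%E.
  by apply: integral_ge0 => y _; rewrite lee_fin.
by rewrite divfK ?gt_eqF ?vol_gt0// fineK// ge0_fin_numE.
Qed.

Lemma avgD r u v x : 0 < r ->
  measurable_fun setT (u : borelType X -> R) -> (forall y, 0 <= u y) ->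
  measurable_fun setT (v : borelType X -> R) -> (forall y, 0 <= v y) ->
  (\int[mu]_(y in ball x r) (u y)%:E < +oo)%E ->
  (\int[mu]_(y in ball x r) (v y)%:E < +oo)%E ->
  avg r (fun y => u y + v y) x = avg r u x + avg r v x.
Proof.
move=> r0 mu_ u0 mv v0 fu fv; rewrite /avg -mulrDl.
under eq_integral do rewrite EFinD.
rewrite ge0_integralD//.
- by rewrite fineD// ge0_fin_numE// integral_ge0// => y _; rewrite lee_fin.
- by move=> y _; rewrite lee_fin.
- by apply: measurable_funTS; apply/measurable_EFinP.
- by move=> y _; rewrite lee_fin.
- by apply: measurable_funTS; apply/measurable_EFinP.
Qed.

(** Young's inequality for [u / U] and [v / N], where [N ^ p] is the mean of
[v ^ p] up to an arbitrarily small error that keeps it positive. *)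
Lemma avg_hoelder p r (U : R) u v x : 1 < p -> 0 < r -> 0 < U ->
  measurable_fun setT (u : borelType X -> R) -> (forall y, 0 <= u y) ->
  measurable_fun setT (v : borelType X -> R) -> (forall y, 0 <= v y) ->
  (\int[mu]_(y in ball x r) (u y `^ (p / (p - 1)))%:E <=
    (U `^ (p / (p - 1)) * vol x r)%:E)%E ->
  (\int[mu]_(y in ball x r) (v y `^ p)%:E < +oo)%E ->
  (\int[mu]_(y in ball x r) (u y * v y)%:E < +oo)%E /\
  avg r (fun y => u y * v y) x `^ p <=
    (2 * U) `^ p * avg r (fun y => v y `^ p) x.
Proof.
move=> p1 r0 U0 mu_ u0 mv v0 uU vfin.
set p' := p / (p - 1); set P := avg r (fun y => v y `^ p) x.
have pp : 0 < p - 1 by lra.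
have p0 : 0 < p by lra.
have p'0 : 0 < p' by rewrite divr_gt0.
have conj : p'^-1 + p^-1 = 1 by rewrite /p'; field; rewrite !gt_eqF.
have P0 : 0 <= P by apply: avg_ge0 => // y; rewrite powR_ge0.
have V0 := vol_gt0 x r0.
have key e : 0 < e -> (\int[mu]_(y in ball x r) (u y * v y)%:E <=
    (2 * U * (P + e) `^ p^-1 * vol x r)%:E)%E.
  move=> e0; set N := (P + e) `^ p^-1; have N0 : 0 < N by rewrite powR_gt0// ltr_wpDl.
  have Np : N `^ p = P + e by rewrite /N powRKV ?gt_eqF//; lra.
  clearbody N.
  pose F y := U * N * U `^ (- p') * u y `^ p'.
  pose G y := U * N * N `^ (- p) * v y `^ p.
  have F0 y : 0 <= F y by rewrite !mulr_ge0 ?powR_ge0 ?ltW.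
  have G0 y : 0 <= G y by rewrite !mulr_ge0 ?powR_ge0 ?ltW.
  have mpow (w : X -> R) (b : R) : measurable_fun setT (w : borelType X -> R) ->
      measurable_fun setT ((fun y => w y `^ b) : borelType X -> R).
    by move=> mw; apply: measurableT_comp (measurable_powR _) mw.
  have mF : measurable_fun setT (F : borelType X -> R).
    by apply: measurable_funM => //; apply: mpow.
  have mG : measurable_fun setT (G : borelType X -> R).
    by apply: measurable_funM => //; apply: mpow.
  apply: (@le_trans _ _ (\int[mu]_(y in ball x r) ((F y)%:E + (G y)%:E))%E).
    apply: ge0_le_integral => //.
    - by move=> y _; rewrite lee_fin mulr_ge0.
    - apply: measurable_funTS; apply/measurable_EFinP.
      exact: measurable_funM.
    - by apply: measurable_funTS; apply: emeasurable_funD;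
        apply/measurable_EFinP.
    move=> y _; rewrite -EFinD lee_fin.
    have uU0 : 0 <= u y / U by rewrite divr_ge0// ltW.
    have vN0 : 0 <= v y / N by rewrite divr_ge0// ltW.
    have := @conjugate_powR R (u y / U) (v y / N) p' p uU0 vN0 p'0 p0 conj.
    rewrite !powRM ?invr_ge0 ?(ltW U0) ?(ltW N0)//.
    rewrite -[U^-1]powR_inv1 ?(ltW U0)// -[N^-1]powR_inv1 ?(ltW N0)//.
    rewrite -!powRrM !mulN1r => young.
    have E1 : u y * v y = U * N * (u y * U `^ (-1) * (v y * N `^ (-1))).
      by rewrite !powR_inv1 ?(ltW U0) ?(ltW N0)//; field; rewrite !gt_eqF.
    rewrite E1 (_ : F y + G y = U * N * (u y `^ p' * U `^ (- p') +
      v y `^ p * N `^ (- p))); last by rewrite /F /G; ring.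
    rewrite ler_pM2l ?mulr_gt0//; apply: (le_trans young); apply: lerD.
      rewrite ler_piMr ?mulr_ge0 ?powR_ge0// invf_le1// /p'.
      by rewrite ler_pdivlMr// mul1r; lra.
    by rewrite ler_piMr ?mulr_ge0 ?powR_ge0// invf_le1// ltW.
  rewrite ge0_integralD//; last 4 first.
  - by move=> y _; rewrite lee_fin.
  - by apply: measurable_funTS; apply/measurable_EFinP.
  - by move=> y _; rewrite lee_fin.
  - by apply: measurable_funTS; apply/measurable_EFinP.
  rewrite (_ : 2 * U * N * vol x r = U * N * vol x r + U * N * vol x r); last by ring.
  rewrite EFinD; apply: leeD.
    under eq_integral do rewrite /F EFinM.
    rewrite ge0_integralZl//; last 3 first.
    - by apply: measurable_funTS; apply/measurable_EFinP; apply: mpow.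
    - by move=> y _; rewrite lee_fin powR_ge0.
    - by rewrite lee_fin !mulr_ge0 ?powR_ge0// ltW.
    apply: le_trans (lee_wpmul2l _ uU) _.
      by rewrite lee_fin !mulr_ge0 ?powR_ge0// ltW.
    rewrite -EFinM lee_fin powRN; apply: eq_ler; rewrite -/p'; field.
    by rewrite gt_eqF ?powR_gt0.
  under eq_integral do rewrite /G EFinM.
  rewrite ge0_integralZl//; last 3 first.
  - by apply: measurable_funTS; apply/measurable_EFinP; apply: mpow.
  - by move=> y _; rewrite lee_fin powR_ge0.
  - by rewrite lee_fin !mulr_ge0 ?powR_ge0// ltW.
  rewrite integral_avg//; last by move=> y; rewrite powR_ge0.
  rewrite -/P -EFinM lee_fin powRN Np.
  rewrite [leLHS](_ : _ = U * N * vol x r * (P / (P + e))); last by ring.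
  rewrite ler_piMr ?mulr_ge0 ?(ltW U0) ?(ltW N0) ?(ltW V0)//.
  by rewrite ler_pdivrMr ?mul1r ?lerDl ?ltr_wpDl// ltW.
split; first exact: le_lt_trans (key 1 ltr01) (ltry _).
apply/ler_addgt0Pl => e e0.
pose e' := e / (2 * U) `^ p.
have K0 : 0 < (2 * U) `^ p by rewrite powR_gt0// mulr_gt0.
have e'0 : 0 < e' by rewrite divr_gt0.
have H : avg r (fun y => u y * v y) x <= 2 * U * (P + e') `^ p^-1.
  by apply: avg_le => //; [move=> y; rewrite mulr_ge0|apply: key].
apply: (@le_trans _ _ ((2 * U * (P + e') `^ p^-1) `^ p)).
  apply: powR_le => //; first exact: ltW.
  by apply: avg_ge0 => // y; rewrite mulr_ge0.
rewrite powRM ?powR_ge0 ?mulr_ge0 ?(ltW U0)// powRKV ?gt_eqF//; last lra.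
have Ke : (2 * U) `^ p * e' = e by rewrite /e' mulrC divfK ?gt_eqF.
by rewrite mulrDr Ke addrC.
Qed.

Lemma avg_jensen p r v x : 1 < p -> 0 < r ->
  measurable_fun setT (v : borelType X -> R) -> (forall y, 0 <= v y) ->
  (\int[mu]_(y in ball x r) (v y `^ p)%:E < +oo)%E ->
  (\int[mu]_(y in ball x r) (v y)%:E < +oo)%E /\
  avg r v x `^ p <= 2 `^ p * avg r (fun y => v y `^ p) x.
Proof.
move=> p1 r0 mv v0 vfin.
have e1 : (fun y => 1 * v y) = v by apply/funext => y; rewrite mul1r.
have one : (\int[mu]_(y in ball x r) (1 `^ (p / (p - 1)))%:E <=
    (1 `^ (p / (p - 1)) * vol x r)%:E)%E.
  by rewrite powR1 integral_cst// mul1e volE// mul1r.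
have [fin le] := @avg_hoelder p r 1 (fun=> 1) v x p1 r0 ltr01
  (measurable_cst _) (fun=> ler01) mv v0 one vfin.
split; last by move: le; rewrite e1 mulr1.
by move: fin; under eq_integral do rewrite mul1r.
Qed.

(** * Fractional integration of order one *)

Lemma integral_avg_le r h : 0 < r ->
  measurable_fun setT (h : borelType X -> R) -> (forall x, 0 <= h x) ->
  (\int[mu]_x (avg r h x)%:E <= CD%:E * \int[mu]_y (h y)%:E)%E.
Proof.
move=> r0 mh h0.
have one y : (\int[mu]_(x in ball y r) 1%:E <= (1 * vol y r)%:E)%E.
  by rewrite integral_cst// mul1r mul1e volE.
have := @avg_swap r h (fun=> 1) (fun=> 1) r0 mh h0 (measurable_cst _)
  (fun=> ler01) (measurable_cst _) (fun=> ler01) one.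
under eq_integral do rewrite mul1r.
under [X in (_ <= X)%E -> _]eq_integral do rewrite mulr1 EFinM.
rewrite ge0_integralZl//.
- exact/measurable_EFinP.
- by move=> y _; rewrite lee_fin.
- by rewrite lee_fin ltW.
Qed.

Lemma ge0_integral_lin2 (f g : X -> R) (a b : R) : 0 <= a -> 0 <= b ->
  measurable_fun setT (f : borelType X -> R) -> (forall x, 0 <= f x) ->
  measurable_fun setT (g : borelType X -> R) -> (forall x, 0 <= g x) ->
  (\int[mu]_x (a * f x + b * g x)%:E =
   a%:E * \int[mu]_x (f x)%:E + b%:E * \int[mu]_x (g x)%:E)%E.
Proof.
move=> a0 b0 mf f0 mg g0.
have Z (k : R) (w : X -> R) : 0 <= k ->
    measurable_fun setT (w : borelType X -> R) -> (forall x, 0 <= w x) ->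
    (k%:E * \int[mu]_x (w x)%:E = \int[mu]_x (k%:E * (w x)%:E))%E.
  move=> k0 mw w0; rewrite ge0_integralZl//; first exact/measurable_EFinP.
  by move=> x _; rewrite lee_fin.
rewrite !Z// -ge0_integralD//.
- by move=> x _; rewrite -EFinM lee_fin mulr_ge0.
- by apply: measurable_funeM; apply/measurable_EFinP.
- by move=> x _; rewrite -EFinM lee_fin mulr_ge0.
- by apply: measurable_funeM; apply/measurable_EFinP.
Qed.

Section fractional_integration.
Variables (p q : R).
Hypothesis p1 : 1 < p.
Hypothesis pq : p < q.
Hypothesis pQ : p < Q.
Hypothesis qE : q = Q * p / (Q - p).

Let p0 : 0 < p := lt_trans ltr01 p1.
Let q0 : 0 < q := lt_trans p0 pq.

Lemma avg_le_mass h x r : 0 < r ->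
  measurable_fun setT (h : borelType X -> R) -> (forall x, 0 <= h x) ->
  (\int[mu]_x (h x `^ p)%:E <= 1)%E ->
  (\int[mu]_(y in ball x r) (h y)%:E < +oo)%E /\
  r * avg r h x <= 2 * c `^ (- p^-1) * r `^ (- (Q / p - 1)).
Proof.
move=> r0 mh h0 h1.
have mhp : measurable_fun setT ((fun y => h y `^ p) : borelType X -> R).
  exact: measurableT_comp (measurable_powR _) mh.
have hB : (\int[mu]_(y in ball x r) (h y `^ p)%:E <= 1)%E.
  apply: le_trans h1; apply: ge0_subset_integral => //.
  - exact/measurable_EFinP.
  - by move=> y _; rewrite lee_fin powR_ge0.
have [fin J] := avg_jensen p1 r0 mh h0 (le_lt_trans hB (ltry 1)).
split=> //.
have a0 : 0 <= avg r h x by apply: avg_ge0.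
have V0 := vol_gt0 x r0.
have cr0 : 0 < c * r `^ Q by rewrite mulr_gt0// powR_gt0.
have A1 : avg r (fun y => h y `^ p) x <= (c * r `^ Q)^-1.
  apply: (@le_trans _ _ (vol x r)^-1).
    apply: avg_le => //; first by move=> y; rewrite powR_ge0.
    by rewrite mulVf ?gt_eqF.
  by rewrite lef_pV2 ?posrE// vol_ge.
rewrite -(@powRK _ (avg r h x) p) ?gt_eqF//.
apply: (@le_trans _ _ (r * (2 `^ p * (c * r `^ Q)^-1) `^ p^-1)).
  rewrite ler_pM2l//; apply: powR_le; rewrite ?powR_ge0 ?invr_ge0 ?(ltW p0)//.
  by apply: (le_trans J); rewrite ler_pM2l ?powR_gt0.
apply: eq_ler; rewrite powRM ?powR_ge0 ?invr_ge0 ?(ltW cr0)// powRK ?gt_eqF//.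
rewrite -powR_inv1 ?(ltW cr0)// -powRrM mulN1r powRM ?powR_ge0 ?(ltW c0)//.
have -> : r `^ (- (Q / p - 1)) = r * (r `^ Q) `^ (- p^-1).
  rewrite -[X in _ = X * _]powRr1 ?(ltW r0)// -powRrM -powRD ?(gt_eqF r0) ?implybT//.
  by congr (_ `^ _); ring.
ring.
Qed.

(** The [L^p]-[L^q] bound for the fractional integral of order one, at the
endpoint [1/q = 1/p - 1/Q]. At the scale [r] the function is cut at the height
[r ^ (- Q/p)], which its averages never exceed by more than a constant. The
sum over the scales decays geometrically in [r], so its [q]-th power is
controlled by sums of lower powers: the first power for the part above the
cut, a power strictly between [p] and [q] for the part below. After
integration these become geometric sums in the scale at each point, bounded by
[h ^ p]. *)
Lemma fractional_integration : exists2 C : R, 0 < C & forall h,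
  measurable_fun setT (h : borelType X -> R) -> (forall x, 0 <= h x) ->
  (\int[mu]_x (h x `^ p)%:E <= 1)%E -> forall eps n, 0 < eps ->
  (\int[mu]_x ((\sum_(k < n) rad[eps, k] * avg rad[eps, k] h x) `^ q)%:E
    <= C%:E)%E.
Proof.
pose a := Q / p - 1.
have a0 : 0 < a by rewrite subr_gt0 ltr_pdivlMr// mul1r.
pose u := (p + q) / 2.
have pu : p < u := (midf_lt pq).1.
have uq : u < q := (midf_lt pq).2.
have u0 : 0 < u := lt_trans p0 pu.
have u1 : 1 < u := lt_trans p1 pu.
have q1 : 1 < q := lt_trans p1 pq.
have Qp0 : 0 < Q - p by rewrite subr_gt0.
have Q0 : 0 < Q := lt_trans p0 pQ.
have aq : a * q = Q by rewrite /a qE; field; rewrite !gt_eqF.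
pose M := 2 * c `^ (- p^-1).
have M0 : 0 < M by rewrite mulr_gt0// powR_gt0.
have [D1 D10 HD1] := powR_sum_decay a0 u0 uq M0.
have [D2 D20 HD2] := powR_sum_decay a0 ltr01 q1 M0.
pose f1 := Q / p * (u - p); pose f2 := Q / p * (p - 1).
have f10 : 0 < f1 by rewrite mulr_gt0 ?divr_gt0 ?subr_gt0.
have f20 : 0 < f2 by rewrite mulr_gt0 ?divr_gt0 ?subr_gt0.
have [K1 K10 HK1] := sum_dyadic_le1 f10.
have [K2 K20 HK2] := sum_dyadic_ge1 f20.
exists (2 `^ q * (D1 * (2 `^ u * (CD * K1)) + D2 * (CD * K2))).
  by rewrite mulr_gt0 ?powR_gt0// addr_gt0// ?mulr_gt0 ?powR_gt0.
move=> h mh h0 h1 eps n eps0.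
have r0 (k : nat) : 0 < rad[eps, k] by rewrite mulr_gt0// exprn_gt0.
pose low r y : bool := r * h y `^ (p / Q) <= 1.
pose hl r y := if low r y then h y else 0.
pose hh r y := if low r y then 0 else h y.
have hl0 r y : 0 <= hl r y by rewrite /hl; case: ifP.
have hh0 r y : 0 <= hh r y by rewrite /hh; case: ifP.
have mlow r : measurable_fun setT (low r : borelType X -> bool).
  apply: measurable_fun_ler => //; apply: measurable_funM => //.
  exact: measurableT_comp (measurable_powR _) mh.
have mhl r : measurable_fun setT (hl r : borelType X -> R).
  by apply: measurable_fun_ifT.
have mhh r : measurable_fun setT (hh r : borelType X -> R).
  by apply: measurable_fun_ifT.
have mpow (w : X -> R) (b : R) : measurable_fun setT (w : borelType X -> R) ->
    measurable_fun setT ((fun y => w y `^ b) : borelType X -> R).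
  by move=> mw; apply: measurableT_comp (measurable_powR _) mw.
have hE r : (fun y => hl r y + hh r y) = h.
  by apply/funext => y; rewrite /hl /hh; case: ifP; rewrite ?addr0 ?add0r.
have le_int (w : X -> R) : measurable_fun setT (w : borelType X -> R) ->
    (forall y, 0 <= w y) -> (forall y, w y <= h y) ->
    (\int[mu]_x (w x `^ p)%:E <= 1)%E.
  move=> mw w0 wh; apply: le_trans h1; apply: ge0_le_integral => //.
  - by move=> y _; rewrite lee_fin powR_ge0.
  - by apply/measurable_EFinP; apply: mpow.
  - by apply/measurable_EFinP; apply: mpow.
  - by move=> y _; rewrite lee_fin powR_le// ltW.
have hlh r y : hl r y <= h y by rewrite /hl; case: ifP.
have hhh r y : hh r y <= h y by rewrite /hh; case: ifP.
pose bl x (k : 'I_n) := rad[eps, k] * avg rad[eps, k] (hl rad[eps, k]) x.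
pose bh x (k : 'I_n) := rad[eps, k] * avg rad[eps, k] (hh rad[eps, k]) x.
have bl0 x k : 0 <= bl x k.
  by rewrite mulr_ge0 ?(ltW (r0 _))//; apply: avg_ge0.
have bh0 x k : 0 <= bh x k.
  by rewrite mulr_ge0 ?(ltW (r0 _))//; apply: avg_ge0.
have Bl x (k : 'I_n) := avg_le_mass x (r0 k) (mhl rad[eps, k])
  (hl0 rad[eps, k]) (le_int _ (mhl _) (hl0 _) (hlh rad[eps, k])).
have Bh x (k : 'I_n) := avg_le_mass x (r0 k) (mhh rad[eps, k])
  (hh0 rad[eps, k]) (le_int _ (mhh _) (hh0 _) (hhh rad[eps, k])).
have blM x k : 0 <= bl x k <= M * rad[eps, k] `^ (- a).
  by rewrite bl0 (Bl x k).2.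
have bhM x k : 0 <= bh x k <= M * rad[eps, k] `^ (- a).
  by rewrite bh0 (Bh x k).2.
have split_sum x : \sum_(k < n) rad[eps, k] * avg rad[eps, k] h x =
    \sum_k bl x k + \sum_k bh x k.
  rewrite -big_split/=; apply: eq_bigr => k _; rewrite -mulrDr; congr (_ * _).
  rewrite -(avgD (r0 k) (mhl _) (hl0 _) (mhh _) (hh0 _) (Bl x k).1 (Bh x k).1).
  by rewrite hE.
pose Fl x (k : 'I_n) := 2 `^ u * rad[eps, k] `^ (u - a * (q - u)) *
  avg rad[eps, k] (fun y => hl rad[eps, k] y `^ u) x.
pose Fh x (k : 'I_n) := rad[eps, k] `^ (1 - a * (q - 1)) *
  avg rad[eps, k] (hh rad[eps, k]) x.
have Fl0 x k : 0 <= Fl x k.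
  apply: mulr_ge0; first by rewrite mulr_ge0 ?powR_ge0.
  by apply: avg_ge0 => // y; rewrite powR_ge0.
have Fh0 x k : 0 <= Fh x k.
  by apply: mulr_ge0; rewrite ?powR_ge0//; apply: avg_ge0.
have mFl k : measurable_fun setT ((fun x => Fl x k) : borelType X -> R).
  apply: measurable_funM => //; apply: measurable_avg => //; first exact: mpow.
  by move=> y; rewrite powR_ge0.
have mFh k : measurable_fun setT ((fun x => Fh x k) : borelType X -> R).
  by apply: measurable_funM => //; apply: measurable_avg.
have hlu x k : (\int[mu]_(y in ball x rad[eps, k])
    (hl rad[eps, k] y `^ u)%:E < +oo)%E.
  (* below the cut, h^u is at most a multiple of h^p *)
  pose L := (rad[eps, k]^-1 `^ (Q / p)) `^ (u - p).
  apply: (@le_lt_trans _ _ (L%:E * 1)%E); last by rewrite mule1 ltry.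
  apply: (@le_trans _ _ (\int[mu]_(y in ball x rad[eps, k])
      (L%:E * (h y `^ p)%:E))%E).
    apply: ge0_le_integral => //.
    - by move=> y _; rewrite lee_fin powR_ge0.
    - by apply: measurable_funTS; apply/measurable_EFinP; apply: mpow.
    - apply: measurable_funTS; apply: measurable_funeM.
      by apply/measurable_EFinP; apply: mpow.
    move=> y _; rewrite -EFinM lee_fin /hl; case: ifPn => lo; last first.
      by rewrite powR0 ?gt_eqF// mulr_ge0 ?powR_ge0.
    have [->|hy] := eqVneq (h y) 0.
      by rewrite !powR0 ?gt_eqF// mulr0.
    have hy0 : 0 < h y by rewrite lt0r hy h0.
    rewrite -[u](subrK p) powRD ?hy ?implybT// ler_wpM2r ?powR_ge0//.
    rewrite /L; apply: powR_le; rewrite ?(ltW hy0) ?subr_ge0 ?(ltW pu)//.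
    rewrite -[leLHS](@powRK _ (h y) (p / Q)) ?(ltW hy0)//; last first.
      by rewrite gt_eqF// divr_gt0.
    rewrite invf_div; apply: powR_le; first by rewrite divr_ge0 ?ltW.
      by rewrite powR_ge0.
    by rewrite -[leRHS]mulr1 ler_pdivlMl.
  rewrite ge0_integralZl//; last 3 first.
  - by apply: measurable_funTS; apply/measurable_EFinP; apply: mpow.
  - by move=> y _; rewrite lee_fin powR_ge0.
  - by rewrite lee_fin powR_ge0.
  rewrite lee_wpmul2l ?lee_fin ?powR_ge0//.
  apply: le_trans h1; apply: ge0_subset_integral => //.
  - by apply/measurable_EFinP; apply: mpow.
  - by move=> y _; rewrite lee_fin powR_ge0.
have pw x : (\sum_(k < n) rad[eps, k] * avg rad[eps, k] h x) `^ q <=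
    \sum_(k < n) 2 `^ q * (D1 * Fl x k + D2 * Fh x k).
  rewrite split_sum -mulr_sumr big_split/= -!mulr_sumr.
  have Sl : (\sum_k bl x k) `^ q <= D1 * \sum_k Fl x k.
    apply: (le_trans (HD1 eps n (bl x) eps0 (blM x))).
    rewrite ler_pM2l//; apply: ler_sum => k _.
    rewrite /bl /Fl powRM ?(ltW (r0 _)) ?avg_ge0//.
    have [_] := avg_jensen u1 (r0 k) (mhl rad[eps, k]) (hl0 _) (hlu x k).
    set A := avg _ _ _; set B := avg _ _ _ => J.
    rewrite powRB; last by rewrite (gt_eqF (r0 k)) implybT.
    rewrite -powRN mulrAC.
    rewrite [leRHS](_ : _ = rad[eps, k] `^ u * rad[eps, k] `^ (- (a * (q - u))) *
      (2 `^ u * B)); last by ring.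
    by rewrite ler_wpM2l// mulr_ge0 ?powR_ge0.
  have Sh : (\sum_k bh x k) `^ q <= D2 * \sum_k Fh x k.
    apply: (le_trans (HD2 eps n (bh x) eps0 (bhM x))).
    rewrite ler_pM2l//; apply: ler_sum => k _; apply: eq_ler.
    rewrite powRr1// /bh /Fh powRB; last by rewrite (gt_eqF (r0 k)) implybT.
    by rewrite -powRN powRr1 ?(ltW (r0 k))// mulrAC.
  have Sl0 : 0 <= \sum_k bl x k by apply: sumr_ge0.
  have Sh0 : 0 <= \sum_k bh x k by apply: sumr_ge0.
  apply: (@le_trans _ _ (2 `^ q * ((\sum_k bl x k) `^ q + (\sum_k bh x k) `^ q))).
    by apply: powR_add_le => //; apply: ltW.
  by rewrite ler_wpM2l ?powR_ge0// lerD.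
apply: (@le_trans _ _ (\int[mu]_x (\sum_(k < n)
    (2 `^ q * (D1 * Fl x k + D2 * Fh x k))%:E))%E).
  apply: ge0_le_integral => //.
  - by move=> x _; rewrite lee_fin powR_ge0.
  - apply/measurable_EFinP; apply: mpow.
    apply: measurable_sum => k; apply: measurable_funM => //.
    exact: measurable_avg.
  - apply: emeasurable_sum => k; apply/measurable_EFinP.
    by apply: measurable_funM => //; apply: measurable_funD;
      apply: measurable_funM.
  - by move=> x _; rewrite sumEFin lee_fin.
rewrite ge0_integral_sum//; last 2 first.
- move=> k; apply/measurable_EFinP.
  by apply: measurable_funM => //; apply: measurable_funD;
    apply: measurable_funM.
- by move=> k x _; rewrite lee_fin mulr_ge0 ?powR_ge0// addr_ge0// mulr_ge0// ltW.
pose Gl y (k : 'I_n) := rad[eps, k] `^ (u - a * (q - u)) * hl rad[eps, k] y `^ u.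
pose Gh y (k : 'I_n) := rad[eps, k] `^ (1 - a * (q - 1)) * hh rad[eps, k] y.
have Gl0 y k : 0 <= Gl y k by rewrite mulr_ge0 ?powR_ge0.
have Gh0 y k : 0 <= Gh y k by rewrite mulr_ge0 ?powR_ge0.
have mGl k : measurable_fun setT ((fun y => Gl y k) : borelType X -> R).
  by apply: measurable_funM => //; apply: mpow.
have mGh k : measurable_fun setT ((fun y => Gh y k) : borelType X -> R).
  by apply: measurable_funM.
have mG k : measurable_fun setT ((fun y => 2 `^ q * (D1 * (2 `^ u * (CD * Gl y k))
    + D2 * (CD * Gh y k))) : borelType X -> R).
  apply: measurable_funM => //; apply: measurable_funD.
    by apply: measurable_funM => //; apply: measurable_funM => //;
      apply: measurable_funM.
  by apply: measurable_funM => //; apply: measurable_funM.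
have G0 y k : 0 <= 2 `^ q * (D1 * (2 `^ u * (CD * Gl y k)) + D2 * (CD * Gh y k)).
  rewrite mulr_ge0 ?powR_ge0// addr_ge0// !mulr_ge0 ?powR_ge0//; exact: ltW.
apply: (@le_trans _ _ (\sum_(k < n) \int[mu]_y
   (2 `^ q * (D1 * (2 `^ u * (CD * Gl y k)) + D2 * (CD * Gh y k)))%:E)%E).
  apply: lee_sum => k _.
  set Al := avg rad[eps, k] (fun y => hl rad[eps, k] y `^ u).
  set Ah := avg rad[eps, k] (hh rad[eps, k]).
  have mhlu : measurable_fun setT
      ((fun y => hl rad[eps, k] y `^ u) : borelType X -> R) by apply: mpow.
  have hlu0 y : 0 <= hl rad[eps, k] y `^ u by rewrite powR_ge0.
  pose al := 2 `^ q * D1 * 2 `^ u * rad[eps, k] `^ (u - a * (q - u)).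
  pose ah := 2 `^ q * D2 * rad[eps, k] `^ (1 - a * (q - 1)).
  have al0 : 0 <= al by rewrite !mulr_ge0 ?powR_ge0 ?(ltW D10).
  have ah0 : 0 <= ah by rewrite !mulr_ge0 ?powR_ge0 ?(ltW D20).
  have CD0' := ltW CD0.
  under eq_integral => x _.
    rewrite (_ : _ * _ = al * Al x + ah * Ah x); last first.
      by rewrite /Fl /Fh -/Al -/Ah /al /ah; ring.
    over.
  under [leRHS]eq_integral => y _.
    rewrite (_ : _ * _ = al * CD * (hl rad[eps, k] y `^ u) +
      ah * CD * (hh rad[eps, k] y)); last by rewrite /Gl /Gh /al /ah; ring.
    over.
  rewrite !ge0_integral_lin2// ?(mulr_ge0 al0) ?(mulr_ge0 ah0)//.
  - rewrite !EFinM -![(_ * CD%:E * _)%E]muleA.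
    by apply: leeD; apply: lee_wpmul2l; rewrite ?lee_fin//; apply: integral_avg_le.
  - exact: measurable_avg.
  - by move=> x; apply: avg_ge0.
  - exact: measurable_avg.
  - by move=> x; apply: avg_ge0.
rewrite -ge0_integral_sum//; last 2 first.
- by move=> k; apply/measurable_EFinP.
- by move=> k y _; rewrite lee_fin.
set K := 2 `^ q * _.
have K0 : 0 <= K.
  rewrite mulr_ge0 ?powR_ge0// addr_ge0// !mulr_ge0 ?powR_ge0//; exact: ltW.
apply: (@le_trans _ _ (\int[mu]_y (K%:E * (h y `^ p)%:E))%E); last first.
  rewrite ge0_integralZl//; last 2 first.
  - by apply/measurable_EFinP; apply: mpow.
  - by move=> y _; rewrite lee_fin powR_ge0.
  by rewrite -[leRHS]mule1 lee_wpmul2l.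
apply: ge0_le_integral => //.
- by move=> y _; apply: sume_ge0 => k _; rewrite lee_fin.
- by apply: emeasurable_sum => k; apply/measurable_EFinP.
- by apply: measurable_funeM; apply/measurable_EFinP; apply: mpow.
move=> y _; rewrite sumEFin -EFinM lee_fin.
rewrite -mulr_sumr big_split/= -!mulr_sumr /K -mulrA ler_wpM2l ?powR_ge0//.
rewrite mulrDl.
have [Ll Lh] : \sum_k Gl y k <= K1 * h y `^ p /\ \sum_k Gh y k <= K2 * h y `^ p.
  have [hy|hy] := eqVneq (h y) 0.
    rewrite hy powR0 ?gt_eqF// !mulr0 !big1// => k _.
      by rewrite /Gh /hh hy if_same mulr0.
    by rewrite /Gl /hl hy if_same powR0 ?mulr0// gt_eqF.
  have hy0 : 0 < h y by rewrite lt0r hy h0.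
  pose t := eps * h y `^ (p / Q).
  have t0 : 0 < t by rewrite mulr_gt0// powR_gt0.
  have tk (k : nat) : t * 2 ^+ k = rad[eps, k] * h y `^ (p / Q).
    by rewrite /t mulrAC.
  split.
    apply: le_trans (ler_wpM2r (powR_ge0 _ _) (HK1 t n t0)).
    rewrite mulr_suml [leRHS]big_mkcond/=; apply: ler_sum => k _.
    rewrite /Gl /hl /low -tk; case: ifP => _; last by rewrite powR0 ?mulr0// gt_eqF.
    rewrite tk powRM ?powR_ge0 ?(ltW (r0 _))// -[(h y `^ _) `^ _]powRrM -[leRHS]mulrA.
    rewrite -powRD; last by rewrite hy implybT.
    apply: eq_ler; congr (_ `^ _ * _ `^ _); last first.
      by rewrite /f1; field; rewrite !gt_eqF.
    rewrite mulrBr aq /f1 /a; field; by rewrite !gt_eqF.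
  apply: le_trans (ler_wpM2r (powR_ge0 _ _) (HK2 t n t0)).
  rewrite mulr_suml [leRHS]big_mkcond/=; apply: ler_sum => k _.
  rewrite /Gh /hh /low -tk; have [tk1|tk1] := leP (t * 2 ^+ k) 1.
    by rewrite mulr0; case: ifP => // _; rewrite mulr_ge0 ?powR_ge0.
  rewrite (ltW tk1) tk powRM ?powR_ge0 ?(ltW (r0 _))//.
  rewrite -[(h y `^ _) `^ _]powRrM -[leRHS]mulrA -powRD; last by rewrite hy implybT.
  rewrite -[X in _ * X <= _]powRr1 ?(ltW hy0)//.
  apply: eq_ler; congr (_ `^ _ * _ `^ _); last first.
    by rewrite /f2; field; rewrite !gt_eqF.
  rewrite mulrBr aq mulr1 /f2 /a; field; by rewrite !gt_eqF.
apply: lerD.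
  by rewrite -!mulrA ler_wpM2l ?(ltW D10)// ler_wpM2l ?powR_ge0// ler_wpM2l// ltW.
by rewrite -!mulrA ler_wpM2l ?(ltW D20)// ler_wpM2l// ltW.
Qed.

End fractional_integration.

(** * A Schur test for powers of the distance *)

(** The size of [d] at a typical point of [B(x, r)]. *)
Definition scale r x : R := Num.max r (d x).

Lemma scale_gt0 r x : 0 < r -> 0 < scale r x.
Proof. by move=> r0; rewrite lt_max r0. Qed.

Lemma scale_ge_r r x : r <= scale r x.
Proof. by rewrite le_max lexx. Qed.

Lemma scale_ge_d r x : d x <= scale r x.
Proof. by rewrite le_max lexx orbT. Qed.

Lemma scale_ball r x y : 0 < r -> ball x r y -> scale r y <= 2 * scale r x.
Proof.
move=> r0 /dist_set_ball xy; have := scale_ge_r r x.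
have := scale_ge_d r x; rewrite /(scale r y) ge_max => h1 h2; apply/andP; lra.
Qed.

Lemma scale_ball_powR r x y a : 0 < r -> ball x r y ->
  scale r y `^ a <= 2 `^ `|a| * scale r x `^ a.
Proof.
move=> r0 xy; apply: powR_comparable; rewrite ?scale_gt0//; apply: scale_ball => //.
exact: ball_sym.
Qed.

Lemma measurable_scale r : measurable_fun setT (scale r : borelType X -> R).
Proof. by apply: measurable_maxr => //; apply: measurable_dist_set. Qed.

Lemma measurable_scale_powR r a :
  measurable_fun setT ((fun x => scale r x `^ a) : borelType X -> R).
Proof. exact: measurableT_comp (measurable_powR _) (measurable_scale r). Qed.

(** In terms of [m = scale r x] this is
[(r / m)^e1 (d x / m)^e2 m^(- e3)]: the first two factors measure how far the
scale [r] is below and above [d x], the third normalizes the function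
[d ^ e3]. *)
Definition schur_weight e1 e2 e3 r x : R :=
  r `^ e1 * d x `^ e2 * scale r x `^ (- e1 - e2 - e3).

Lemma measurable_schur_weight e1 e2 e3 r :
  measurable_fun setT (schur_weight e1 e2 e3 r : borelType X -> R).
Proof.
apply: measurable_funM; last exact: measurable_scale_powR.
by apply: measurable_funM => //; apply: measurable_dist_powR.
Qed.

(** On a ball of radius below [d x / 2] the weight is almost constant. *)
Lemma avg_weight_local G b x r : 0 < r -> r < d x / 2 ->
  measurable_fun setT (G : borelType X -> R) -> (forall y, 0 <= G y) ->
  (\int[mu]_(y in ball x r) (G y * d y `^ b)%:E < +oo)%E ->
  avg r G x <= 2 `^ `|b| * d x `^ (- b) * avg r (fun y => G y * d y `^ b) x.
Proof.
move=> r0 rd mG G0 hfin; have dx : 0 < d x by lra.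
have K0 : 0 <= 2 `^ `|b| * d x `^ (- b) by rewrite mulr_ge0 ?powR_ge0.
have h0 y : 0 <= G y * d y `^ b by rewrite mulr_ge0 ?powR_ge0.
have mh : measurable_fun setT ((fun y => G y * d y `^ b) : borelType X -> R).
  by apply: measurable_funM => //; apply: measurable_dist_powR.
apply: avg_le => //; rewrite -mulrA EFinM -integral_avg//.
rewrite -ge0_integralZl//; last 2 first.
- by apply: measurable_funTS; apply/measurable_EFinP.
- by move=> y _; rewrite lee_fin h0.
apply: ge0_le_integral => //.
- by move=> y _; rewrite lee_fin G0.
- by apply: measurable_funTS; apply/measurable_EFinP.
- by apply: measurable_funTS; apply: measurable_funeM; apply/measurable_EFinP.
move=> y /dist_set_ball /andP[xy1 xy2]; rewrite -EFinM lee_fin.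
have [xy yx dy] : [/\ d x <= 2 * d y, d y <= 2 * d x & 0 < d y] by split; lra.
have one : 1 <= 2 `^ `|b| * d x `^ (- b) * d y `^ b.
  rewrite mulrAC powRN (ler_pdivlMr _ _ (powR_gt0 _ dx)) mul1r.
  exact: powR_comparable.
by rewrite mulrCA; apply: ler_peMr.
Qed.

(** Moving the means to the other side replaces [(d x / m)^e2] by its mean, a
constant, and leaves [H y] times the sum over the scales of
[(r / m)^e1 (d y / m)^e3], which is bounded. *)
Lemma schur_integral e1 e2 e3 : 0 < e1 -> - rho < e2 -> 0 < e3 ->
  exists2 C : R, 0 < C & forall H,
    measurable_fun setT (H : borelType X -> R) -> (forall x, 0 <= H x) ->
    (\int[mu]_x (H x)%:E <= 1)%E -> forall eps n, 0 < eps ->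
    (\int[mu]_x (\sum_(k < n) schur_weight e1 e2 e3 rad[eps, k] x *
       avg rad[eps, k] (fun y => H y * d y `^ e3) x)%:E <= C%:E)%E.
Proof.
move=> e10 e20 e30.
have [C C0 HC] := integral_dist_powR e20.
have [K K0 HK] := sum_dyadic_max e10 e30.
pose b := - e1 - e2 - e3; pose C2 := 2 `^ `|b| * C.
have C20 : 0 < C2 by rewrite mulr_gt0// powR_gt0.
exists (CD * C2 * K) => [|H mH H0 H1 eps n eps0]; first by rewrite !mulr_gt0.
have r0 (k : nat) : 0 < rad[eps, k] by rewrite mulr_gt0// exprn_gt0.
have mH' : measurable_fun setT ((fun y => H y * d y `^ e3) : borelType X -> R).
  by apply: measurable_funM => //; apply: measurable_dist_powR.
have H'0 y : 0 <= H y * d y `^ e3 by rewrite mulr_ge0 ?powR_ge0.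
have w0 r x : 0 <= schur_weight e1 e2 e3 r x by rewrite !mulr_ge0 ?powR_ge0.
have term0 (k : nat) x : 0 <= schur_weight e1 e2 e3 rad[eps, k] x *
    avg rad[eps, k] (fun y => H y * d y `^ e3) x.
  by rewrite mulr_ge0// avg_ge0.
under eq_integral do rewrite -sumEFin.
rewrite ge0_integral_sum//; last 2 first.
- move=> k; apply/measurable_EFinP; apply: measurable_funM.
    exact: measurable_schur_weight.
  exact: measurable_avg.
- by move=> k x _; rewrite lee_fin.
pose psi r y : R := C2 * r `^ e1 * scale r y `^ (- e1 - e3).
have psi0 r y : 0 <= psi r y by rewrite !mulr_ge0 ?powR_ge0// ltW.
have mpsi r : measurable_fun setT (psi r : borelType X -> R).
  by apply: measurable_funM => //; apply: measurable_scale_powR.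
have Hpsi r y : 0 < r ->
    (\int[mu]_(x in ball y r) (schur_weight e1 e2 e3 r x)%:E
     <= (psi r y * vol y r)%:E)%E.
  move=> r_gt0; pose M : R := r `^ e1 * (2 `^ `|b| * scale r y `^ b).
  have M0 : 0 <= M by rewrite !mulr_ge0 ?powR_ge0.
  apply: (@le_trans _ _ (\int[mu]_(x in ball y r) (M%:E * (d x `^ e2)%:E))%E).
    apply: ge0_le_integral => //.
    - by move=> x _; rewrite lee_fin.
    - apply: measurable_funTS; apply/measurable_EFinP.
      exact: measurable_schur_weight.
    - apply: measurable_funTS; apply: measurable_funeM; apply/measurable_EFinP.
      exact: measurable_dist_powR.
    move=> x yx; rewrite -EFinM lee_fin /schur_weight /M -mulrA -[leRHS]mulrA.
    rewrite ler_wpM2l ?powR_ge0// mulrC ler_wpM2r ?powR_ge0//.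
    exact: scale_ball_powR.
  rewrite ge0_integralZl//; last 2 first.
  - apply: measurable_funTS; apply/measurable_EFinP.
    exact: measurable_dist_powR.
  - by move=> x _; rewrite lee_fin powR_ge0.
  apply: le_trans (lee_wpmul2l _ (HC y r r_gt0)) _; first by rewrite lee_fin.
  rewrite -EFinM lee_fin; apply: eq_ler; rewrite /M /psi /C2 -/(scale r y).
  have -> : - e1 - e3 = b + e2 by rewrite /b; ring.
  rewrite [scale r y `^ (b + _)]powRD; first by ring.
  by rewrite (gt_eqF (scale_gt0 _ r_gt0)) implybT.
have mHpsi r : measurable_fun setT
    ((fun y => CD * (H y * d y `^ e3 * psi r y)) : borelType X -> R).
  by apply: measurable_funM => //; apply: measurable_funM.
have t0 r y : 0 <= CD * (H y * d y `^ e3 * psi r y).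
  exact: mulr_ge0 (ltW CD0) (mulr_ge0 (H'0 y) (psi0 r y)).
apply: (@le_trans _ _ (\sum_(k < n) \int[mu]_y
    (CD * (H y * d y `^ e3 * psi rad[eps, k] y))%:E)%E).
  apply: lee_sum => k _; apply: avg_swap => //.
  - exact: measurable_schur_weight.
  - by move=> y; apply: Hpsi.
rewrite -ge0_integral_sum//; last 2 first.
- by move=> k; apply/measurable_EFinP.
- by move=> k y _; rewrite lee_fin t0.
have CK0 : 0 <= CD * C2 * K by rewrite !mulr_ge0 ?ltW.
apply: (@le_trans _ _ (\int[mu]_y ((CD * C2 * K)%:E * (H y)%:E))%E); last first.
  rewrite ge0_integralZl//; last 2 first.
  - exact/measurable_EFinP.
  - by move=> y _; rewrite lee_fin.
  by apply: le_trans (lee_wpmul2l _ H1) _; rewrite ?mule1.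
apply: ge0_le_integral => //.
- by move=> y _; apply: sume_ge0 => k _;
    rewrite lee_fin t0.
- by apply: emeasurable_sum => k; apply/measurable_EFinP.
- by apply: measurable_funeM; apply/measurable_EFinP.
move=> y _; rewrite sumEFin -EFinM lee_fin.
have [dy0|dy0] := eqVneq (d y) 0.
  rewrite big1 ?(mulr_ge0 CK0 (H0 y))// => k _.
  by rewrite dy0 powR0 ?gt_eqF// mulr0 mul0r mulr0.
have {}dy0 : 0 < d y by rewrite lt0r dy0 dist_set_ge0.
rewrite (eq_bigr (fun k : 'I_n => CD * C2 * H y *
    ((rad[eps, k] / scale rad[eps, k] y) `^ e1 *
     (d y / scale rad[eps, k] y) `^ e3))); last first.
  move=> k _; move: (rad[eps, k]) (r0 k) => r r_gt0.
  have s0 := scale_gt0 y r_gt0.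
  rewrite !powRM ?invr_ge0 ?(ltW s0) ?(ltW r_gt0) ?dist_set_ge0//.
  rewrite -[(scale _ _)^-1]powR_inv1 ?(ltW s0)// -!powRrM !mulN1r /psi.
  rewrite [scale _ _ `^ (- e1 - _)]powRD; first by ring.
  by rewrite (gt_eqF s0) implybT.
rewrite -mulr_sumr [leRHS]mulrAC ler_wpM2l ?HK//.
exact: mulr_ge0 (mulr_ge0 (ltW CD0) (ltW C20)) (H0 y).
Qed.

Variables (p q beta : R).
Hypothesis p1 : 1 < p.
Hypothesis pq : p <= q.
Let s := q / p * (Q - p + beta) - Q.
Let theta := 1 + Q / q - Q / p.
Hypothesis rho_s : - rho < s.
Hypothesis rho_beta : beta / (p - 1) < rho.

Let p0 : 0 < p := lt_trans ltr01 p1.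
Let q0 : 0 < q := lt_le_trans p0 pq.

(** Hölder's inequality for [G = d^(- beta/p - gm) * (G d^(beta/p + gm))] on one
ball; the first factor has the conjugate exponent below [rho]. The [q/p]-th
power of the resulting mean is reduced to its first power by the lower mass
bound and the normalization of [G]. *)
Lemma schur_avg gm : 0 < gm -> (beta / p + gm) * (p / (p - 1)) < rho ->
  exists2 C : R, 0 < C & forall G,
    measurable_fun setT (G : borelType X -> R) -> (forall x, 0 <= G x) ->
    (forall x, d x = 0 -> G x = 0) ->
    (\int[mu]_x (G x `^ p * d x `^ beta)%:E <= 1)%E ->
    forall x r, 0 < r -> (\int[mu]_(y in ball x r) (G y)%:E < +oo)%E /\
      avg r G x `^ q <= C * r `^ (- (Q * (q / p - 1))) * scale r x `^ (- (beta * q / p) - gm * p) *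
      avg r (fun y => G y `^ p * d y `^ beta * d y `^ (gm * p)) x.
Proof.
move=> gm0 gmr; set p' := p / (p - 1) in gmr *.
have p'0 : 0 < p' by rewrite divr_gt0// subr_gt0.
have gmr' : - rho < - ((beta / p + gm) * p') by rewrite ltrN2.
have [C C0 HC] := integral_dist_powR gmr'.
pose bg := beta / p + gm.
pose U0 := C `^ p'^-1.
have U00 : 0 < U0 by rewrite powR_gt0.
pose h := q / p - 1.
have h0 : 0 <= h by rewrite /h subr_ge0 ler_pdivlMr ?mul1r.
exists ((2 * U0) `^ q * (2 `^ (gm * p)) `^ h * c `^ (- h)).
  by rewrite !mulr_gt0 ?powR_gt0 ?mulr_gt0.
move=> G mG G0 Gd G1 x r r0.
have sc := scale_gt0 x r0; have V0 := vol_gt0 x r0.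
have mpow (w : X -> R) (b : R) : measurable_fun setT (w : borelType X -> R) ->
    measurable_fun setT ((fun y => w y `^ b) : borelType X -> R).
  by move=> mw; apply: measurableT_comp (measurable_powR _) mw.
pose H y := G y `^ p * d y `^ beta.
have H0 y : 0 <= H y by rewrite mulr_ge0 ?powR_ge0.
have mH : measurable_fun setT (H : borelType X -> R).
  by apply: measurable_funM; apply: mpow.
pose u y := d y `^ (- bg); pose v y := G y * d y `^ bg.
have uv : (fun y => u y * v y) = G.
  apply/funext => y; rewrite /u /v; have [dy|dy] := eqVneq (d y) 0.
    by rewrite Gd// mul0r mulr0.
  by rewrite powRN; field; rewrite powR_eq0 negb_and dy.
have vp y : v y `^ p = H y * d y `^ (gm * p).
  rewrite /v powRM ?powR_ge0// -powRrM /H; have [dy|dy] := eqVneq (d y) 0.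
    by rewrite Gd// powR0 ?gt_eqF// !mul0r.
  rewrite -mulrA -powRD ?dy ?implybT//; congr (_ * _ `^ _).
  by rewrite /bg; field; rewrite gt_eqF.
pose A := avg r (fun y => H y * d y `^ (gm * p)) x.
have A0 : 0 <= A by apply: avg_ge0 => // y; rewrite mulr_ge0 ?powR_ge0.
have IH : (\int[mu]_(y in ball x r) (H y * d y `^ (gm * p))%:E
    <= ((2 * scale r x) `^ (gm * p))%:E)%E.
  apply: (@le_trans _ _
      (\int[mu]_(y in ball x r) (((2 * scale r x) `^ (gm * p))%:E * (H y)%:E))%E).
    apply: ge0_le_integral => //.
    - by move=> y _; rewrite lee_fin mulr_ge0 ?powR_ge0.
    - apply: measurable_funTS; apply/measurable_EFinP.
      by apply: measurable_funM => //; apply: mpow.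
    - apply: measurable_funTS; apply: measurable_funeM.
      exact/measurable_EFinP.
    move=> y xy; rewrite -EFinM lee_fin mulrC ler_wpM2r//.
    apply: powR_le => //; first by rewrite mulr_ge0 ?ltW.
    exact: le_trans (scale_ge_d r y) (scale_ball r0 xy).
  rewrite ge0_integralZl//; last 3 first.
  - by apply: measurable_funTS; apply/measurable_EFinP.
  - by move=> y _; rewrite lee_fin.
  - by rewrite lee_fin powR_ge0.
  rewrite -[leRHS]mule1 lee_wpmul2l ?lee_fin ?powR_ge0//.
  apply: le_trans G1; apply: ge0_subset_integral => //.
  - exact/measurable_EFinP.
  - by move=> y _; rewrite lee_fin.
have AV : A <= (2 * scale r x) `^ (gm * p) / vol x r.
  apply: avg_le => //; first by move=> y; rewrite mulr_ge0 ?powR_ge0.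
  by rewrite divfK ?gt_eqF.
have [] := @avg_hoelder p r (U0 * scale r x `^ (- bg)) u v x p1 r0.
- by rewrite mulr_gt0 ?powR_gt0.
- exact: mpow.
- by move=> y; rewrite powR_ge0.
- by apply: measurable_funM => //; apply: mpow.
- by move=> y; rewrite mulr_ge0 ?powR_ge0.
- under eq_integral do rewrite /u -powRrM mulNr.
  rewrite -/p' powRM ?powR_ge0// -powRrM mulNr /U0 powRKV ?gt_eqF ?(ltW C0)//.
  exact: HC.
- by under eq_integral do rewrite vp; apply: le_lt_trans IH (ltry _).
rewrite uv => Gfin HA; split.
  by move: Gfin; under eq_integral do rewrite (congr1 (@^~ _) uv).
move: HA.
have -> : (fun y => v y `^ p) = (fun y => H y * d y `^ (gm * p)).
  exact/funext.
rewrite -/A => HA.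
have a0 : 0 <= avg r G x by apply: avg_ge0.
have -> : avg r G x `^ q = (avg r G x `^ p) `^ (q / p).
  by rewrite -powRrM; congr (_ `^ _); field; rewrite gt_eqF.
apply: (@le_trans _ _
    (((2 * (U0 * scale r x `^ (- bg))) `^ p * A) `^ (q / p))).
  by apply: powR_le; rewrite ?powR_ge0// divr_ge0 ?ltW.
have Ah : A `^ (q / p) <= A * ((2 * scale r x) `^ (gm * p) / (c * r `^ Q)) `^ h.
  have -> : q / p = 1 + h by rewrite /h; ring.
  have [->|An0] := eqVneq A 0.
    by rewrite powR0 ?mul0r// gt_eqF//; lra.
  rewrite powRD; last by rewrite An0 implybT.
  rewrite powRr1// ler_wpM2l//; apply: powR_le => //; apply: (le_trans AV).
  rewrite ler_wpM2l ?powR_ge0// lef_pV2 ?posrE ?mulr_gt0 ?powR_gt0//.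
  exact: vol_ge.
rewrite powRM ?powR_ge0//; apply: le_trans (ler_wpM2l _ Ah) _.
  exact: powR_ge0.
have cr0 : 0 < c * r `^ Q by rewrite mulr_gt0// powR_gt0.
have e1 : ((2 * (U0 * scale r x `^ (- bg))) `^ p) `^ (q / p) =
    (2 * U0) `^ q * scale r x `^ (- (bg * q)).
  rewrite mulrA -powRrM [p * _]mulrC divfK ?gt_eqF// powRM ?powR_ge0//.
    by rewrite -powRrM mulNr.
  by rewrite mulr_ge0// ltW.
have e2 : ((2 * scale r x) `^ (gm * p) / (c * r `^ Q)) `^ h =
    (2 `^ (gm * p)) `^ h * scale r x `^ (gm * p * h) *
    (c `^ (- h) * r `^ (- (Q * h))).
  rewrite powRM ?powR_ge0 ?invr_ge0 ?(ltW cr0)//; congr (_ * _).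
    by rewrite powRM ?(ltW sc)// powRM ?powR_ge0// -[X in _ * X]powRrM.
  rewrite -[(c * _)^-1]powR_inv1 ?(ltW cr0)// -powRrM mulN1r.
  by rewrite powRM ?powR_ge0 ?(ltW c0)// -powRrM mulrN.
have e3 : scale r x `^ (- (bg * q)) * scale r x `^ (gm * p * h) =
    scale r x `^ (- (beta * q / p) - gm * p).
  rewrite -powRD; last by rewrite (gt_eqF sc) implybT.
  by congr (_ `^ _); rewrite /bg /h; field; rewrite gt_eqF.
by rewrite e1 e2 -e3 -/A -/h; apply: eq_ler; ring.
Qed.

(** Normalized right-hand sides, restricted to the complement of the zero set of
[d] so that the weight can be taken real-valued. *)
Definition admissible G := [/\ measurable_fun setT (G : borelType X -> R),
  forall x, 0 <= G x, forall x, d x = 0 -> G x = 0 &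
  (\int[mu]_x (G x `^ p * d x `^ beta)%:E <= 1)%E].

(** The weights of the sum over the scales are the powers [eta] of
[(r / m) (d x / m) = min(r / d x, d x / r)]. The set [P] of scales at each point
is one on which the factor [(r / m)^(theta q)] coming from the exponents is at
most a power [th'] that may be chosen positive. *)
Lemma schur_pointwise (P : R -> R -> bool) (th' M gm eta : R) :
  0 < gm -> (beta / p + gm) * (p / (p - 1)) < rho -> 0 < eta -> 0 < M ->
  (forall r t, 0 < r -> 0 < t -> P r t ->
    (r / Num.max r t) `^ (theta * q) <= M * (r / Num.max r t) `^ (th' * q)) ->
  exists2 C : R, 0 < C & forall G, admissible G -> forall x eps n,
    0 < d x -> 0 < eps ->
    (\sum_(k < n | P rad[eps, k] (d x)) rad[eps, k] * avg rad[eps, k] G x) `^ q *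
      d x `^ s <=
    C * \sum_(k < n)
      schur_weight ((th' - eta) * q) (s - eta * q) (gm * p) rad[eps, k] x *
      avg rad[eps, k] (fun y => G y `^ p * d y `^ beta * d y `^ (gm * p)) x.
Proof.
move=> gm0 gmr eta0 M0 HP.
have [C1 C10 HC1] := @schur_avg gm gm0 gmr.
have [K K0 HK] := sum_dyadic_max eta0 eta0.
exists (K `^ q * (C1 * M)) => [|G [mG G0 Gd G1] x eps n dx eps0].
  by rewrite !mulr_gt0// powR_gt0.
have r0 (k : nat) : 0 < rad[eps, k] by rewrite mulr_gt0// exprn_gt0.
pose w (k : 'I_n) := (rad[eps, k] / scale rad[eps, k] x) `^ eta *
  (d x / scale rad[eps, k] x) `^ eta.
have w0 k : 0 < w k.
  by rewrite mulr_gt0// powR_gt0// divr_gt0// scale_gt0.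
have avg0 (k : 'I_n) : 0 <= avg rad[eps, k] G x by apply: avg_ge0.
have b0 (k : 'I_n) : 0 <= rad[eps, k] * avg rad[eps, k] G x.
  by rewrite mulr_ge0// ltW.
have wK : \sum_(k < n | P rad[eps, k] (d x)) w k <= K.
  apply: le_trans (HK (d x) eps n dx eps0); rewrite big_mkcond/=.
  by apply: ler_sum => k _; case: ifP => // _; apply: ltW (w0 k).
have := @powR_sum_weight R 'I_n (fun k => P rad[eps, k] (d x)) _ w q K q0
  (fun k _ => w0 k) (fun k _ => b0 k) wK.
move=> /(ler_wpM2r (powR_ge0 (d x) s)) /le_trans; apply.
rewrite -!mulrA ler_wpM2l ?powR_ge0// mulr_suml mulrA mulr_sumr big_mkcond/=.
apply: ler_sum => k _.
have A0 : 0 <= avg rad[eps, k]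
    (fun y => G y `^ p * d y `^ beta * d y `^ (gm * p)) x.
  by apply: avg_ge0 => // y; rewrite !mulr_ge0 ?powR_ge0.
case: ifP => [PK|_]; last first.
  apply: mulr_ge0; first by rewrite mulr_ge0 ?(ltW C10) ?(ltW M0).
  by apply: mulr_ge0 => //; rewrite !mulr_ge0 ?powR_ge0.
have sc := scale_gt0 x (r0 k).
have := (HC1 G mG G0 Gd G1 x _ (r0 k)).2.
have := HP _ _ (r0 k) dx PK; rewrite -/(scale _ x).
rewrite /w.
move: (avg _ _ x) A0 => A A0; move: (avg _ G x) (avg0 k) => B B0.
move: (rad[eps, k]) (r0 k) sc => r rr; rewrite /schur_weight.
move: (scale r x) => m sc HM HB.
pose W := r `^ q * ((r / m) `^ eta * (d x / m) `^ eta) `^ (- q) * d x `^ s.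
have W0 : 0 <= W by rewrite !mulr_ge0 ?powR_ge0.
rewrite (powRM _ (ltW rr) B0) [leLHS](_ : _ = W * B `^ q); last by rewrite /W; ring.
apply: (le_trans (ler_wpM2l W0 HB)).
pose D := r `^ (- (eta * q)) * d x `^ (s - eta * q) *
  m `^ (2 * (eta * q) - s - gm * p).
have D0 : 0 <= D by rewrite !mulr_ge0 ?powR_ge0.
(* both sides are monomials in r, m and d x, and the exponents agree *)
have e1 : W * (r `^ (- (Q * (q / p - 1))) * m `^ (- (beta * q / p) - gm * p)) =
    (r / m) `^ (theta * q) * D.
  rewrite /W /D -(lnK rr) -(lnK sc) -(lnK dx).
  do 3 (rewrite -?expRN -?expRD -?expRM).
  by congr expR; rewrite /theta /s; field; rewrite !gt_eqF.
have e2 : (r / m) `^ (th' * q) * D =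
    r `^ ((th' - eta) * q) * d x `^ (s - eta * q) *
    m `^ (- ((th' - eta) * q) - (s - eta * q) - gm * p).
  rewrite /D -(lnK rr) -(lnK sc) -(lnK dx).
  do 3 (rewrite -?expRN -?expRD -?expRM).
  by congr expR; ring.
rewrite [leLHS](_ : _ = C1 * A * (W * (r `^ (- (Q * (q / p - 1))) *
  m `^ (- (beta * q / p) - gm * p)))); last by ring.
rewrite e1 -e2 [leRHS](_ : _ = C1 * A * (M * (r / m) `^ (th' * q) * D)); last by ring.
rewrite ler_wpM2l ?mulr_ge0 ?(ltW C10)// ler_wpM2r//.
Qed.

(** The room between [beta / (p - 1)] and [rho], halved and written as a change
of [beta / p]. *)
Lemma conjugate_slack :
  exists gm : R, 0 < gm /\ (beta / p + gm) * (p / (p - 1)) < rho.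
Proof.
have pp : 0 < p - 1 by rewrite subr_gt0.
exists ((rho - beta / (p - 1)) / 2 * ((p - 1) / p)); split.
  by rewrite mulr_gt0 ?divr_gt0// subr_gt0.
rewrite (_ : _ * _ = (beta / (p - 1) + rho) / 2); first exact: (midf_lt _).2.
by field; rewrite !gt_eqF.
Qed.

Lemma admissible_integrable G x r : admissible G -> 0 < r ->
  (\int[mu]_(y in ball x r) (G y)%:E < +oo)%E.
Proof.
move=> [mG G0 Gd G1] r0; have [gm [gm0 gmr]] := conjugate_slack.
have [C _ HC] := @schur_avg gm gm0 gmr.
exact: (HC G mG G0 Gd G1 x r r0).1.
Qed.

(** The bound is stated through an integrable majorant because the sum runs over
a set of scales that depends on the point, for which no measurability is
assumed. *)
Lemma operator_bound_positive (P : R -> R -> bool) (th' M : R) :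
  0 < th' -> 0 < M ->
  (forall r t, 0 < r -> 0 < t -> P r t ->
    (r / Num.max r t) `^ (theta * q) <= M * (r / Num.max r t) `^ (th' * q)) ->
  exists C : R, 0 < C /\ forall G, admissible G -> forall eps n, 0 < eps ->
    exists F : X -> R, [/\ measurable_fun setT (F : borelType X -> R),
      forall x, 0 <= F x, (\int[mu]_x (F x)%:E <= C%:E)%E &
      forall x, 0 < d x ->
      (\sum_(k < n | P rad[eps, k] (d x)) rad[eps, k] * avg rad[eps, k] G x) `^ q *
      d x `^ s <= F x].
Proof.
move=> th0 M0 HP.
have [gm [gm0 gmr]] := conjugate_slack.
have sr : 0 < s + rho by rewrite -ltrBlDr sub0r.
pose eta := Num.min (th' / 2) ((s + rho) / (2 * q)).
have eta0 : 0 < eta by rewrite lt_min !divr_gt0 ?mulr_gt0.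
have eth : 0 < (th' - eta) * q.
  rewrite mulr_gt0// subr_gt0; apply: (@le_lt_trans _ _ (th' / 2)).
    by rewrite ge_min lexx.
  by rewrite ltr_pdivrMr// ltr_pMr// ltr1n.
have es : - rho < s - eta * q.
  have : eta * q <= (s + rho) / 2.
    rewrite (_ : (s + rho) / 2 = (s + rho) / (2 * q) * q); last first.
      by field; rewrite gt_eqF.
    by rewrite ler_wpM2r ?(ltW q0)// ge_min lexx orbT.
  by move: (eta * q) sr; move: s => s' e; lra.
have [C1 C10 HC1] := schur_pointwise gm0 gmr eta0 M0 HP.
have gmp : 0 < gm * p by rewrite mulr_gt0.
have [C2 C20 HC2] := schur_integral eth es gmp.
exists (C1 * C2); split=> [|G aG eps n eps0]; first by rewrite mulr_gt0.
have [mG G0 Gd G1] := aG.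
pose H y := G y `^ p * d y `^ beta.
have mH : measurable_fun setT (H : borelType X -> R).
  apply: measurable_funM; last exact: measurable_dist_powR.
  exact: measurableT_comp (measurable_powR _) mG.
have H0 y : 0 <= H y by rewrite mulr_ge0 ?powR_ge0.
have r0 (k : nat) : 0 < rad[eps, k] by rewrite mulr_gt0// exprn_gt0.
pose F x := \sum_(k < n)
  schur_weight ((th' - eta) * q) (s - eta * q) (gm * p) rad[eps, k] x *
  avg rad[eps, k] (fun y => H y * d y `^ (gm * p)) x.
have F0 x : 0 <= F x.
  apply: sumr_ge0 => k _; apply: mulr_ge0; first by rewrite !mulr_ge0 ?powR_ge0.
  by apply: avg_ge0 => // y; rewrite mulr_ge0 ?powR_ge0.
have mF : measurable_fun setT (F : borelType X -> R).
  apply: measurable_sum => k; apply: measurable_funM.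
    exact: measurable_schur_weight.
  apply: measurable_avg => //; last by move=> y; rewrite mulr_ge0 ?powR_ge0.
  by apply: measurable_funM => //; apply: measurable_dist_powR.
exists (fun x => C1 * F x); split.
- exact: measurable_funM.
- by move=> x; rewrite mulr_ge0// ltW.
- under eq_integral do rewrite EFinM.
  rewrite ge0_integralZl//; last 3 first.
  + exact/measurable_EFinP.
  + by move=> y _; rewrite lee_fin.
  + by rewrite lee_fin ltW.
  rewrite EFinM lee_wpmul2l ?lee_fin ?(ltW C10)//.
  exact: HC2.
- by move=> x dx; apply: HC1.
Qed.

Hypothesis pQ : p < Q.

(** For [theta > 0] all scales satisfy [operator_bound_positive]. For
[theta = 0] the scales with [d x / 2 <= r] do, because there [r / m >= 1/2], and
the others are estimated by a fractional integral. *)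
Lemma operator_bound : 0 <= theta -> exists C : R, 0 < C /\ forall G, admissible G ->
  forall eps n, 0 < eps ->
  exists F : X -> R, [/\ measurable_fun setT (F : borelType X -> R),
    forall x, 0 <= F x, (\int[mu]_x (F x)%:E <= C%:E)%E &
    forall x, 0 < d x ->
    (\sum_(k < n) rad[eps, k] * avg rad[eps, k] G x) `^ q * d x `^ s <= F x].
Proof.
move=> theta0; have [th|th] := ltrP 0 theta.
  apply: (@operator_bound_positive (fun _ _ => true) theta 1) => // r t _ _ _.
  by rewrite mul1r.
have {th} th : theta = 0 by apply/eqP; rewrite eq_le th.
have M0 : 0 < 2 `^ (1 * q) :> R by rewrite powR_gt0.
have [|C1 [C10 HC1]] := @operator_bound_positive (fun r t => t / 2 <= r) 1 _
    ltr01 M0.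
  move=> r t r0 t0 tr; rewrite th mul0r powRr0 -powRM//; last first.
    by rewrite divr_ge0 ?(ltW r0)// le_max (ltW r0).
  rewrite -[leLHS](powR1r (1 * q)); apply: powR_le; rewrite ?mul1r ?(ltW q0)//.
  rewrite mulrA ler_pdivlMr ?mul1r ?lt_max ?r0//.
  by rewrite maxEle; case: ifP => _; lra.
have Qp : 0 < Q - p by rewrite subr_gt0.
have Q0 : 0 < Q := lt_trans p0 pQ.
have qE : q = Q * p / (Q - p).
  have : theta * (q * p) = 0 by rewrite th mul0r.
  rewrite /theta => e.
  have {e} : q * (Q - p) = Q * p.
    apply/eqP; rewrite -subr_eq0 -oppr_eq0 -[X in _ == X]e; apply/eqP.
    by field; rewrite !gt_eqF.
  by move=> <-; rewrite mulfK ?gt_eqF.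
have pq' : p < q.
  rewrite {1}qE ltr_pdivlMr// mulrC ltr_pM2r// ltrBlDr ltrDl; exact: p0.
have [C2 C20 HC2] := fractional_integration p1 pq' pQ qE.
pose b := beta / p.
have sE : s = b * q.
  rewrite /s /b (_ : q / p * (Q - p + beta) - Q = beta / p * q - theta * q).
    by rewrite th mul0r subr0.
  by rewrite /theta; field; rewrite !gt_eqF.
pose L := (2 `^ `|b|) `^ q.
have L0 : 0 < L by rewrite !powR_gt0.
exists (2 `^ q * (C1 + L * C2)); split=> [|G aG eps n eps0].
  by rewrite mulr_gt0 ?powR_gt0// addr_gt0// mulr_gt0.
have [F1 [mF1 F10 F1C HF1]] := HC1 G aG eps n eps0.
have [mG G0 Gd G1] := aG.
have r0 (k : nat) : 0 < rad[eps, k] by rewrite mulr_gt0// exprn_gt0.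
pose h y := G y * d y `^ b.
have h0 y : 0 <= h y by rewrite mulr_ge0 ?powR_ge0.
have mh : measurable_fun setT (h : borelType X -> R).
  by apply: measurable_funM => //; apply: measurable_dist_powR.
have h1 : (\int[mu]_y (h y `^ p)%:E <= 1)%E.
  under eq_integral => y _.
    rewrite /h powRM ?powR_ge0// -powRrM /b divfK ?gt_eqF//.
    over.
  exact: G1.
pose T x := \sum_(k < n) rad[eps, k] * avg rad[eps, k] h x.
have mT : measurable_fun setT (T : borelType X -> R).
  apply: measurable_sum => k; apply: measurable_funM => //.
  exact: measurable_avg.
have mTq : measurable_fun setT ((fun x => T x `^ q) : borelType X -> R).
  exact: measurableT_comp (measurable_powR _) mT.
have T0 x : 0 <= T x.
  by apply: sumr_ge0 => k _; rewrite mulr_ge0 ?(ltW (r0 _))//; apply: avg_ge0.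
exists (fun x => 2 `^ q * (F1 x + L * T x `^ q)); split.
- by apply: measurable_funM => //; apply: measurable_funD => //; apply: measurable_funM.
- by move=> x; rewrite mulr_ge0 ?powR_ge0// addr_ge0// mulr_ge0 ?powR_ge0 ?(ltW L0).
- under eq_integral do rewrite mulrDr mulrA.
  rewrite ge0_integral_lin2 ?mulr_ge0 ?powR_ge0//; last first.
    by move=> x; rewrite powR_ge0.
  rewrite mulrDr mulrA EFinD !EFinM -!muleA.
  apply: leeD; apply: lee_wpmul2l; rewrite ?lee_fin ?powR_ge0//.
  by apply: lee_wpmul2l; rewrite ?lee_fin ?powR_ge0//; apply: HC2.
move=> x dx.
have avg0 (k : 'I_n) : 0 <= avg rad[eps, k] G x by apply: avg_ge0.
have hfin (k : 'I_n) : (\int[mu]_(y in ball x rad[eps, k]) (h y)%:E < +oo)%E.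
  exact: (avg_le_mass p1 x (r0 k) mh h0 h1).1.
have loc (k : 'I_n) : rad[eps, k] < d x / 2 ->
    avg rad[eps, k] G x <= 2 `^ `|b| * d x `^ (- b) * avg rad[eps, k] h x.
  by move=> rd; apply: avg_weight_local => //; apply: hfin.
have small : \sum_(k < n | ~~ (d x / 2 <= rad[eps, k])) rad[eps, k] *
    avg rad[eps, k] G x <= 2 `^ `|b| * d x `^ (- b) * T x.
  rewrite big_mkcond/= mulr_sumr; apply: ler_sum => k _.
  have ah0 : 0 <= avg rad[eps, k] h x by apply: avg_ge0.
  case: ifPn => [rd|_]; last first.
    apply: mulr_ge0; first by rewrite mulr_ge0 ?powR_ge0.
    exact: mulr_ge0 (ltW (r0 _)) ah0.
  rewrite [leRHS]mulrCA ler_wpM2l ?(ltW (r0 _))//; apply: loc.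
  by rewrite ltNge.
rewrite (bigID (fun k : 'I_n => d x / 2 <= rad[eps, k]))/=.
set A := (X in (X + _) `^ q * _ <= _); set B := (X in (_ + X) `^ q * _ <= _).
have A0 : 0 <= A by apply: sumr_ge0 => k _; rewrite mulr_ge0// ltW.
have B0 : 0 <= B by apply: sumr_ge0 => k _; rewrite mulr_ge0// ltW.
have AF : A `^ q * d x `^ s <= F1 x := HF1 x dx.
have BT : B <= 2 `^ `|b| * d x `^ (- b) * T x := small.
clearbody A B.
apply: le_trans (ler_wpM2r (powR_ge0 _ _) (powR_add_le (ltW q0) A0 B0)) _.
rewrite -mulrA ler_wpM2l ?powR_ge0// mulrDl; apply: lerD => //.
apply: le_trans (ler_wpM2r (powR_ge0 _ _) (powR_le (ltW q0) B0 BT)) _.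
rewrite powRM ?mulr_ge0 ?powR_ge0// powRM ?powR_ge0// -/L -[(d x `^ _) `^ _]powRrM.
rewrite mulNr -sE; apply: eq_ler; rewrite powRN; field.
by rewrite gt_eqF ?powR_gt0.
Qed.

Let Q0 : 0 < Q := lt_trans p0 pQ.

(** * Telescoping of means *)

Lemma lipschitz_integrable f (L : R) x r : 0 <= L ->
  (forall y z, `|f y - f z| <= L * mdist y z) -> 0 < r ->
  mu.-integrable (ball x r) (EFin \o f).
Proof.
move=> L0 Lf r0; have mf := lipschitz_measurable Lf.
apply/integrableP; split.
  by apply: measurable_funTS; apply/measurable_EFinP.
apply: (@le_lt_trans _ _ ((`|f x| + L * r) * vol x r)%:E); last exact: ltry.
apply: integral_ball_le_cst => //.
- by rewrite addr_ge0// mulr_ge0// ltW.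
- by apply: measurableT_comp => //; apply/measurable_EFinP.
- move=> y; rewrite in_ball => xy; rewrite lee_fin.
  have := Lf y x; have := ler_normD (f y - f x) (f x); rewrite subrK metric_sym.
  have : L * mdist x y <= L * r by rewrite ler_wpM2l// ltW.
  lra.
Qed.

Section lipschitz_function.
Variables (f : X -> R) (L : R).
Hypothesis L0 : 0 <= L.
Hypothesis Lf : forall x y, `|f x - f y| <= L * mdist x y.

Let mf : measurable_fun setT (f : borelType X -> R).
Proof. exact: lipschitz_measurable Lf. Qed.

Lemma average_lipschitz x r : 0 < r ->
  average mu (ball x r) (EFin \o f) = (avg r f x)%:E.
Proof.
move=> r0; rewrite /average volE// inver gt_eqF ?vol_gt0//.
have := integrable_fin_num (measurable_ballm x r) (lipschitz_integrable x L0 Lf r0).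
by rewrite /avg EFinM => fin; rewrite fineK.
Qed.

Lemma dist_avg_le x r (m M : R) : 0 < r ->
  (\int[mu]_(y in ball x r) `|f y - m|%:E <= (M * vol x r)%:E)%E ->
  `|avg r f x - m| <= M.
Proof.
move=> r0 hM; have V0 := vol_gt0 x r0.
have fi := lipschitz_integrable x L0 Lf r0.
have mi : mu.-integrable (ball x r) (EFin \o cst m).
  apply: (@lipschitz_integrable (cst m) 0) => // y z.
  by rewrite subrr normr0 mul0r.
have fE : (\int[mu]_(y in ball x r) (f y)%:E = (avg r f x * vol x r)%:E)%E.
  by rewrite divfK ?gt_eqF// fineK//; apply: integrable_fin_num fi.
have : (`|\int[mu]_(y in ball x r) ((f y)%:E - m%:E)| <= (M * vol x r)%:E)%E.
  apply: le_trans hM; apply: le_abse_integral => //.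
  by apply: emeasurable_funB; apply: measurable_funTS; apply/measurable_EFinP.
rewrite (integralB_EFin (measurable_ballm x r) fi mi) fE.
rewrite [X in (_ - X)%E](integral_cst mu (measurable_ballm x r) m%:E) volE//.
rewrite -EFinM -EFinB abse_EFin lee_fin -mulrBl normrM (gtr0_norm V0).
by rewrite ler_pM2r.
Qed.

Lemma avg_lipschitz x r : 0 < r -> `|avg r f x - f x| <= L * r.
Proof.
move=> r0; apply: dist_avg_le => //; apply: integral_ball_le_cst => //.
- by rewrite mulr_ge0// ltW.
- apply/measurable_EFinP; apply: measurableT_comp => //.
  exact: measurable_funB.
- move=> y; rewrite in_ball => xy; rewrite lee_fin.
  apply: (le_trans (Lf y x)); rewrite ler_wpM2l// metric_sym ltW//.
Qed.

Lemma avg_support x0 r0 x r : 0 < r0 -> 0 < r ->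
  (forall y, ~ ball x0 r0 y -> f y = 0) ->
  `|avg r f x| <= (`|f x0| + L * r0) * vol x0 r0 / (c * r `^ Q).
Proof.
move=> r00 rr f0; set M := `|f x0| + L * r0.
have M0 : 0 <= M by rewrite addr_ge0// mulr_ge0// ltW.
rewrite -[avg r f x]subr0; apply: dist_avg_le => //.
have mnf : measurable_fun setT ((fun y => `|f y|) : borelType X -> R).
  exact: measurableT_comp.
apply: (@le_trans _ _ (\int[mu]_y `|f y|%:E)%E).
  under eq_integral do rewrite subr0.
  apply: ge0_subset_integral => //.
  - exact/measurable_EFinP.
apply: (@le_trans _ _ (\int[mu]_(y in ball x0 r0) `|f y|%:E)%E).
  rewrite [leRHS]integral_mkcond le_eqVlt; apply/orP; left; apply/eqP.
  apply: eq_integral => y _; rewrite /patch; case: ifPn => // /negP yN.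
  by rewrite f0 ?normr0// => yB; apply: yN; rewrite inE.
apply: (@le_trans _ _ (M * vol x0 r0)%:E).
  apply: integral_ball_le_cst => //; first exact/measurable_EFinP.
  move=> y; rewrite in_ball => xy; rewrite lee_fin /M.
  have := Lf y x0; have := ler_normD (f y - f x0) (f x0); rewrite subrK metric_sym.
  have : L * mdist x0 y <= L * r0 by rewrite ler_wpM2l// ltW.
  lra.
rewrite lee_fin mulrAC ler_pdivlMr ?mulr_gt0 ?powR_gt0//.
by rewrite ler_wpM2l ?vol_ge// mulr_ge0// ltW// vol_gt0.
Qed.

Variables (CP tau : R).
Hypothesis CP0 : 0 < CP.
Hypothesis tau1 : 1 <= tau.
Variable g : X -> \bar R.
Hypothesis poincare : forall x r, 0 < r ->
  (average mu (ball x r)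
     (fun y => (`|(f y)%:E - average mu (ball x r) (EFin \o f)|))
   <= (CP * r)%:E * average mu (ball x (tau * r)) g)%E.
Variables (G : X -> R) (A : R).
Hypothesis A0 : 0 < A.
Hypothesis G0 : forall x, 0 <= G x.
Hypothesis Gfin : forall x r, 0 < r ->
  (\int[mu]_(y in ball x r) (G y)%:E < +oo)%E.
Hypothesis gG : forall x r, 0 < r ->
  (\int[mu]_(y in ball x r) g y <= A%:E * \int[mu]_(y in ball x r) (G y)%:E)%E.

Let tau0 : 0 < tau := lt_le_trans ltr01 tau1.

(** Enlarging [B(x, r)] to [B(x, 2 r)] costs the doubling constant, after which
the Poincaré inequality applies. *)
Lemma avg_step x r : 0 < r -> `|avg r f x - avg (2 * r) f x| <=
  CD * CP * A / tau * (tau * (2 * r) * avg (tau * (2 * r)) G x).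
Proof.
move=> r0; have r20 : 0 < 2 * r by rewrite mulr_gt0.
have tr0 : 0 < tau * (2 * r) by rewrite mulr_gt0.
have V2 := vol_gt0 x r20; have Vt := vol_gt0 x tr0; have V := vol_gt0 x r0.
apply: dist_avg_le => //; set m := avg (2 * r) f x.
have mfm : measurable_fun setT ((fun y => `|f y - m|%:E) : borelType X -> \bar R).
  by apply/measurable_EFinP; apply: measurableT_comp => //; apply: measurable_funB.
apply: (@le_trans _ _ (\int[mu]_(y in ball x (2 * r)) `|f y - m|%:E)%E).
  apply: ge0_subset_integral => //.
  - exact: measurable_funTS.
  - by apply: ball_subset; rewrite mdistxx; lra.
have := poincare x r20; rewrite average_lipschitz// /average !volE//.
rewrite !inver !gt_eqF ?vol_gt0// lee_pdivrMr// => /le_trans; apply.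
set a := avg (tau * (2 * r)) G x.
apply: (@le_trans _ _ ((CP * (2 * r))%:E * (A * a)%:E * (vol x (2 * r))%:E)%E).
  rewrite lee_wpmul2r ?lee_fin ?(ltW V2)// lee_wpmul2l ?lee_fin ?mulr_ge0 ?(ltW CP0) ?(ltW r0)//.
  rewrite lee_pdivrMr// -EFinM -mulrA EFinM.
  apply: (le_trans (gG x tr0)); rewrite lee_wpmul2l ?lee_fin ?(ltW A0)//.
  by rewrite integral_avg//; apply: Gfin.
rewrite -!EFinM lee_fin.
have a0 : 0 <= a by apply: avg_ge0.
rewrite [leRHS](_ : _ = CP * (2 * r) * (A * a) * (CD * vol x r)); last first.
  by field; rewrite gt_eqF.
have P0 : 0 <= CP * (2 * r) * (A * a).
  exact: mulr_ge0 (mulr_ge0 (ltW CP0) (ltW r20)) (mulr_ge0 (ltW A0) a0).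
by rewrite ler_wpM2l// vol_double.
Qed.

(** Telescoping the means of [f] over the balls [B(x, t 2^k)]: at small scales
they tend to [f x], and at large scales to zero because [f] has bounded support
and the mass of balls is unbounded. Both limits are uniform in [x]. *)
Lemma le_sum_avg x0 r0 eta : 0 < r0 -> (forall y, ~ ball x0 r0 y -> f y = 0) ->
  0 < eta -> exists eps n, 0 < eps /\ forall x,
  `|f x| <= eta + CD * CP * A / tau * \sum_(k < n) rad[eps, k] * avg rad[eps, k] G x.
Proof.
move=> r00 f0 eta0; set K := CD * CP * A / tau.
pose t := eta / (2 * (L + 1)).
have L1 : 0 < L + 1 by rewrite ltr_wpDl.
have t0 : 0 < t by rewrite divr_gt0// mulr_gt0.
have Lt : L * t <= eta / 2.
  rewrite /t mulrA ler_pdivrMr ?mulr_gt0//.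
  rewrite [leRHS](_ : _ = eta * (L + 1)); last by field.
  by rewrite mulrC ler_wpM2l ?(ltW eta0)// lerDl.
pose M := (`|f x0| + L * r0) * vol x0 r0.
have M0 : 0 <= M.
  by rewrite mulr_ge0 ?(ltW (vol_gt0 _ _))// addr_ge0// mulr_ge0// ltW.
pose Y := 2 * M / (c * eta).
have ce0 : 0 < c * eta := mulr_gt0 c0 eta0.
have Y0 : 0 <= Y by apply: divr_ge0 (ltW ce0); apply: mulr_ge0.
pose n := Num.truncn (Y `^ Q^-1 / t).
have tn0 (k : nat) : 0 < t * 2 ^+ k by rewrite mulr_gt0// exprn_gt0.
have Yn : Y <= (t * 2 ^+ n) `^ Q.
  rewrite -[leLHS](@powRKV _ Y Q) ?gt_eqF//; apply: powR_le; rewrite ?powR_ge0 ?(ltW Q0)//.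
  rewrite mulrC -ler_pdivrMr//; apply: le_trans (ltW (truncnS_gt _)) _.
  by rewrite -natrX ler_nat ltn_expl.
(* the means of G are over balls of radius tau * t * 2^(k+1) *)
exists (tau * (2 * t)), n; split=> [|x].
  by apply: mulr_gt0 tau0 (mulr_gt0 _ t0).
have tele : `|avg t f x - avg (t * 2 ^+ n) f x| <=
    K * \sum_(k < n) rad[tau * (2 * t), k] * avg rad[tau * (2 * t), k] G x.
  elim: (n) => [|j IH]; first by rewrite expr0 mulr1 subrr normr0 big_ord0 mulr0.
  rewrite big_ord_recr/= mulrDr.
  apply: le_trans (ler_distD (avg (t * 2 ^+ j) f x) _ _) _.
  apply: lerD => //; have := avg_step x (tn0 j); rewrite -/K.
  rewrite (_ : t * 2 ^+ j.+1 = 2 * (t * 2 ^+ j)); last by rewrite exprS; ring.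
  by rewrite (_ : tau * (2 * (t * 2 ^+ j)) = tau * (2 * t) * 2 ^+ j); last by ring.
have small := avg_lipschitz x t0.
have large := avg_support x r00 (tn0 n) f0.
have {}large : `|avg (t * 2 ^+ n) f x| <= eta / 2.
  apply: (le_trans large); rewrite -/M ler_pdivrMr ?mulr_gt0 ?powR_gt0//.
  have : c * eta / 2 * Y <= c * eta / 2 * (t * 2 ^+ n) `^ Q.
    by rewrite ler_wpM2l// divr_ge0// mulr_ge0 ?ltW.
  rewrite [leLHS](_ : _ = M); last by rewrite /Y; field; rewrite !gt_eqF.
  by move=> /le_trans; apply; apply: eq_ler; ring.
move: tele small large Lt; set S := K * _.
move: (avg t f x) (avg (t * 2 ^+ n) f x) => a b tele small large Lt.
have := ler_normD (f x - a) (a - b); have := ler_normD (f x - a + (a - b)) b.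
rewrite (distrC a (f x)) in small.
rewrite addrA subrK subrK; lra.
Qed.

End lipschitz_function.

(** * The weighted inequality *)

Variables (CP tau : R).
Hypothesis CP0 : 0 < CP.
Hypothesis tau1 : 1 <= tau.
Hypothesis poincare : forall x r f g, 0 < r ->
  measurable_fun setT (f : borelType X -> R) -> upper_gradient g f ->
  mu.-integrable (ball x r) (EFin \o f) ->
  (average mu (ball x r)
     (fun y => (`|(f y)%:E - average mu (ball x r) (EFin \o f)|))
   <= (CP * r)%:E * average mu (ball x (tau * r)) g)%E.

Hypothesis qQ : q <= Q * p / (Q - p).

Lemma dist_neq0_ae : 0 < rho -> {ae mu, forall x : borelType X, d x != 0}.
Proof.
move=> rho1; exists [set x | d x = 0]; split.
- exact: measurable_dist_eq0.
- exact: dist_eq0_null.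
- by move=> x /= /negP; rewrite negbK => /eqP.
Qed.

(** If the right-hand side is finite, [g] is finite almost everywhere off the
zero set of [d]. On that set [g] vanishes almost everywhere if [beta < 0],
because the weight is infinite there; if [beta >= 0], the set is null. *)
Lemma admissible_of_gradient g (A : R) : 0 < A ->
  measurable_fun setT (g : borelType X -> \bar R) -> (forall x, 0 <= g x)%E ->
  (\int[mu]_x (g x `^ p * powR_infty (d x) beta) <= A%:E)%E ->
  exists G, admissible G /\ forall x r, 0 < r ->
   (\int[mu]_(y in ball x r) g y <=
     (A `^ p^-1)%:E * \int[mu]_(y in ball x r) (G y)%:E)%E.
Proof.
move=> A0 mg g0 gA; pose B := A `^ p^-1.
have B0 : 0 < B by rewrite powR_gt0.
have Bp : B `^ p = A by rewrite powRKV ?gt_eqF// ltW.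
pose W x : \bar R := (g x `^ p * powR_infty (d x) beta)%E.
have W0 x : (0 <= W x)%E by rewrite mule_ge0 ?poweR_ge0 ?powR_infty_ge0.
have mW : measurable_fun setT (W : borelType X -> \bar R).
  apply: emeasurable_funM; last exact: measurable_weight.
  exact: measurableT_comp (measurable_poweR _) mg.
pose G y := if d y == 0 then 0 else B^-1 * fine (g y).
have G0 y : 0 <= G y.
  by rewrite /G; case: ifP => // _; rewrite mulr_ge0 ?invr_ge0 ?fine_ge0// ltW.
have mG : measurable_fun setT (G : borelType X -> R).
  apply: measurable_fun_ifT => //.
    by apply: measurable_fun_eqr.
  by apply: measurable_funM => //; apply: measurableT_comp.
have GW y : ((G y `^ p * d y `^ beta)%:E <= A^-1%:E * W y)%E.
  rewrite /G /W; have [dy|dy] := eqVneq (d y) 0.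
    by rewrite powR0 ?gt_eqF// mul0r mule_ge0 ?lee_fin ?invr_ge0 ?(ltW A0)// -/(W y).
  have {}dy : 0 < d y by rewrite lt0r dy dist_set_ge0.
  rewrite powR_infty_gt0//.
  move: (g0 y); case: (g y) => [v v0| _|//]; last first.
    rewrite mulr0 powR0 ?gt_eqF// mul0r mule_ge0 ?lee_fin ?invr_ge0 ?(ltW A0)//.
    by rewrite mule_ge0 ?poweR_ge0// lee_fin powR_ge0.
  rewrite lee_fin in v0.
  rewrite poweR_EFin -!EFinM lee_fin/= powRM ?invr_ge0 ?(ltW B0)//.
  rewrite -[B^-1]powR_inv1 ?(ltW B0)// -powRrM mulN1r powRN Bp.
  by rewrite mulrA.
exists G; split.
  split=> //; first by move=> y; rewrite /G => ->; rewrite eqxx.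
  apply: (@le_trans _ _ (\int[mu]_x (A^-1%:E * W x))%E).
    apply: ge0_le_integral => //.
    - by move=> y _; rewrite lee_fin mulr_ge0 ?powR_ge0.
    - apply/measurable_EFinP; apply: measurable_funM.
        exact: measurableT_comp (measurable_powR _) mG.
      exact: measurable_dist_powR.
    - exact: measurable_funeM.
  rewrite ge0_integralZl// ?lee_fin ?invr_ge0 ?(ltW A0)//.
  apply: (@le_trans _ _ (A^-1%:E * A%:E)%E).
    by rewrite lee_wpmul2l ?lee_fin ?invr_ge0 ?(ltW A0).
  by rewrite -EFinM mulVf ?gt_eqF.
move=> x r r0; rewrite -ge0_integralZl//; last 3 first.
- by apply: measurable_funTS; apply/measurable_EFinP.
- by move=> y _; rewrite lee_fin.
- by rewrite lee_fin ltW.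
apply: ae_ge0_le_integral => //.
- exact: measurable_funTS.
- by move=> y _; rewrite mule_ge0 ?lee_fin// ltW.
- by apply: measurable_funTS; apply: measurable_funeM; apply/measurable_EFinP.
have Wint : mu.-integrable setT W.
  apply/integrableP; split=> //; under eq_integral do rewrite gee0_abs//.
  exact: le_lt_trans gA (ltry _).
have key y : W y \is a fin_num -> (0 <= beta -> d y != 0) ->
    (g y <= B%:E * (G y)%:E)%E.
  rewrite /W /G; have [dy|dy] := eqVneq (d y) 0.
    move=> + bN; have beta0 : beta < 0 by rewrite ltNge; apply/negP => /bN.
    rewrite dy /powR_infty eqxx beta0/= mule0.
    have [->//|gy] := eqVneq (g y) 0%E.
    by rewrite gt0_muley// poweR_gt0// lt0e gy g0.
  have {}dy : 0 < d y by rewrite lt0r dy dist_set_ge0.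
  rewrite powR_infty_gt0// => + _.
  move: (g0 y); case: (g y) => [v v0 _| _|//].
    by rewrite -EFinM lee_fin mulrA mulfV ?gt_eqF// mul1r.
  by rewrite poweRyr ?gt_eqF// gt0_mulye// lte_fin powR_gt0.
have Wae := integrable_ae measurableT Wint.
have [beta0|beta0] := leP 0 beta; last first.
  apply: filterS Wae => y Wy _; apply: key; first exact: Wy.
  by move=> b0; move: beta0; rewrite ltNge b0.
have rho1 : 0 < rho.
  by apply: le_lt_trans rho_beta; rewrite divr_ge0// subr_ge0 ltW.
apply: filterS2 (dist_neq0_ae rho1) Wae => y dy Wy _.
by apply: key => //; apply: Wy.
Qed.

(** The inequality for a real upper bound [A] of the right-hand side. Where
[2 eta <= |f|], the error [eta] of the telescoping is absorbed in the left-hand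
side; the zero set of [d] carries no part of the left-hand integral, since
either [s > 0] and the weight vanishes there, or the set is null. *)
Lemma hardy_sobolev : exists C : R, 0 < C /\
  forall f g (A : R), Lip0 f -> upper_gradient g f -> 0 < A ->
  (\int[mu]_x (g x `^ p * powR_infty (d x) beta) <= A%:E)%E ->
  ((\int[mu]_x ((`|f x| `^ q)%:E * powR_infty (d x) s)) `^ q^-1
    <= (C * A `^ p^-1)%:E)%E.
Proof.
have theta0 : 0 <= 1 + Q / q - Q / p.
  have Qp : 0 < Q - p by rewrite subr_gt0.
  rewrite (_ : _ - _ = (Q * p - q * (Q - p)) / (q * p)); last first.
    by field; rewrite !gt_eqF.
  by rewrite divr_ge0 ?mulr_ge0 ?(ltW p0) ?(ltW q0)// subr_ge0 -ler_pdivlMr.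
have [C [C0 HC]] := operator_bound theta0.
pose K := 2 * (CD * CP / tau).
have tau0 : 0 < tau := lt_le_trans ltr01 tau1.
have K0 : 0 < K by rewrite mulr_gt0// divr_gt0// mulr_gt0.
exists (K * C `^ q^-1); split; first by rewrite mulr_gt0// powR_gt0.
move=> f g A [[L0 Lf0] [x0 [r0 [r00 f0]]]] gf A0 gA.
pose L := `|L0|; have Lge0 : 0 <= L by apply: normr_ge0.
have Lf x y : `|f x - f y| <= L * mdist x y.
  by apply: (le_trans (Lf0 x y)); rewrite ler_wpM2r ?mdist_ge0 ?ler_norm.
have mf := lipschitz_measurable Lf.
have [mg g0 _] := gf.
have [G [aG gG]] := admissible_of_gradient A0 mg g0 gA.
pose B := A `^ p^-1; have B0 : 0 < B by rewrite powR_gt0.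
have [mG G0 _ _] := aG.
have Gfin x r (r_gt0 : 0 < r) := admissible_integrable x aG r_gt0.
have poinc x r (r_gt0 : 0 < r) := poincare r_gt0 mf gf
  (lipschitz_integrable x Lge0 Lf r_gt0).
pose W x : \bar R := ((`|f x| `^ q)%:E * powR_infty (d x) s)%E.
have W0 x : (0 <= W x)%E by rewrite mule_ge0 ?powR_infty_ge0// lee_fin powR_ge0.
have mfq : measurable_fun setT ((fun x => `|f x| `^ q) : borelType X -> R).
  by apply: measurableT_comp (measurable_powR _) _; apply: measurableT_comp.
have mW : measurable_fun setT (W : borelType X -> \bar R).
  by apply: emeasurable_funM; [apply/measurable_EFinP|apply: measurable_weight].
pose S (m : nat) : set (borelType X) := [set x | 0 < d x /\ 2 / m.+1%:R <= `|f x|].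
have mS m : measurable (S m).
  rewrite (_ : S m = (d @^-1` `]0, +oo[%classic) `&`
    ((fun x => `|f x|) @^-1` `[2 / m.+1%:R, +oo[%classic)); last first.
    by apply/seteqP; split=> x /=; rewrite !in_itv/= !andbT.
  apply: measurableI; rewrite -[X in measurable X]setTI.
    by apply: measurable_dist_set => //; apply: measurable_itv.
  have mnf : measurable_fun setT ((fun x => `|f x|) : borelType X -> R).
    exact: measurableT_comp.
  by apply: mnf => //; apply: measurable_itv.
have ndS : nondecreasing_seq S.
  apply/nondecreasing_seqP => m; apply/subsetPset => x [dx fx]; split=> //.
  by apply: le_trans fx; rewrite ler_pM2l// lef_pV2 ?posrE// ler_nat.
pose M := (K * B) `^ q * C.
have SM m : (\int[mu]_(x in S m) W x <= M%:E)%E.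
  have eta0 : 0 < (m.+1%:R)^-1 :> R by rewrite invr_gt0.
  have [eps [n [eps0 Hf]]] := le_sum_avg Lge0 Lf CP0 tau1
    poinc B0 G0 Gfin gG r00 f0 eta0.
  have [F [mF F0 FC HF]] := HC G aG eps n eps0.
  have KB0 : 0 <= (K * B) `^ q by rewrite powR_ge0.
  apply: (@le_trans _ _ (\int[mu]_(x in S m) (((K * B) `^ q)%:E * (F x)%:E))%E).
    apply: ge0_le_integral => //.
    - exact: measurable_funTS.
    - by apply: measurable_funTS; apply: measurable_funeM; apply/measurable_EFinP.
    move=> x [dx fx]; rewrite /W powR_infty_gt0// -!EFinM lee_fin.
    set T := \sum_(k < n) rad[eps, k] * avg rad[eps, k] G x.
    have T0 : 0 <= T.
      apply: sumr_ge0 => k _; apply: mulr_ge0.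
        by rewrite mulr_ge0// ?(ltW eps0)// exprn_ge0.
      by apply: avg_ge0 => //; rewrite mulr_gt0// exprn_gt0.
    have fT : `|f x| <= K * B * T.
      have := Hf x; rewrite -/T.
      rewrite (_ : K * B * T = 2 * (CD * CP * B / tau * T)); last by rewrite /K; ring.
      move: fx (CD * CP * B / tau * T) => /[swap] U; move: (m.+1%:R^-1) => e.
      by move: (`|f x|) => v; lra.
    apply: (@le_trans _ _ ((K * B * T) `^ q * d x `^ s)).
      by rewrite ler_wpM2r ?powR_ge0// powR_le// ltW.
    rewrite (powRM _ (mulr_ge0 (ltW K0) (ltW B0)) T0) -mulrA ler_wpM2l//.
    exact: HF.
  rewrite ge0_integralZl//; last 2 first.
  - by apply: measurable_funTS; apply/measurable_EFinP.
  - by move=> y _; rewrite lee_fin.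
  rewrite /M EFinM lee_wpmul2l ?lee_fin//; apply: le_trans FC.
  apply: ge0_subset_integral => //.
  - exact/measurable_EFinP.
  - by move=> y _; rewrite lee_fin.
have SW : (\int[mu]_x W x = \int[mu]_(x in \bigcup_m S m) W x)%E.
  rewrite [RHS]integral_mkcond; apply: ge0_ae_eq_integral => //.
  - apply/(measurable_restrictT _ _).1; first exact: bigcupT_measurable.
    exact: measurable_funTS.
  - by move=> x _; apply: erestrict_ge0.
  have out x : (s <= 0 -> d x != 0) -> W x = (W \_ (\bigcup_m S m)) x.
    rewrite /patch => dx; case: ifPn => // /negP xS; rewrite /W.
    have [->|fx] := eqVneq (f x) 0.
      by rewrite normr0 powR0 ?gt_eqF// mul0e.
    have [dx0|dx0] := eqVneq (d x) 0; last first.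
      exfalso; apply: xS; rewrite inE.
      have nf : 0 < `|f x| by rewrite normr_gt0.
      exists (Num.truncn (2 / `|f x|)) => //; split.
        by rewrite lt0r dx0 dist_set_ge0.
      by rewrite ler_pdivrMr// mulrC -ler_pdivrMr// ltW// truncnS_gt.
    have s0 : 0 < s by rewrite ltNge; apply/negP => /dx; rewrite dx0 eqxx.
    by rewrite /powR_infty dx0 eqxx ltNge (ltW s0)/= powR0 ?gt_eqF// mule0.
  have [s0|s0] := ltP 0 s.
    by apply: aeW => x _; apply: out; rewrite leNgt s0.
  have rho1 : 0 < rho by rewrite -oppr_lt0; apply: lt_le_trans s0.
  by apply: filterS (dist_neq0_ae rho1) => x dx _; apply: out.
have WM : (\int[mu]_x W x <= M%:E)%E.
  rewrite SW; have cv := @ge0_nondecreasing_set_cvg_integral _ _ R S W mu ndS mS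
    (fun i => measurable_funTS mW) (fun i x _ => W0 x).
  rewrite -(cvg_lim _ cv)//; apply: lime_le; first exact: cvgP cv.
  exact: nearW.
have Wi0 : (0 <= \int[mu]_x W x)%E by apply: integral_ge0.
rewrite -/B -/(W _).
apply: (@le_trans _ _ (M%:E `^ q^-1)%E).
  apply: gt0_ler_poweR => //; first by rewrite invr_ge0 ltW.
  - by rewrite in_itv/= leey Wi0.
  - by rewrite in_itv/= leey lee_fin mulr_ge0 ?powR_ge0// ltW.
rewrite poweR_EFin lee_fin /M (powRM _ (powR_ge0 _ _) (ltW C0)).
rewrite (powRK (lt0r_neq0 q0) (mulr_ge0 (ltW K0) (ltW B0))).
by apply: eq_ler; ring.
Qed.

End hardy_sobolev.

Theorem theorem6p1 (R : realType) (X : pmetricType R)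
    (mu : {measure set (borelType X) -> \bar R}) (Q : R)
    (E : set X) (p q beta : R) :
  balls_positive_finite mu ->
  @unbounded R X ->
  doubling mu ->
  poincare11 mu ->
  reverse_doubling mu ->
  1 < Q -> lower_mass_bound mu Q ->
  E !=set0 -> closed E ->
  1 < p -> p <= q -> p < Q -> q <= Q * p / (Q - p) ->
  ((Num.max (Q - q / p * (Q - p + beta)) (beta / (p - 1)))%:E
     < lower_codim_Assouad mu E)%E ->
  exists C : R, 0 < C /\
    forall (f : X -> R) (g : X -> \bar R), Lip0 f -> upper_gradient g f ->
      ((\int[mu]_x ((`|f x| `^ q)%:E *
          powR_infty (dist_set E x) (q / p * (Q - p + beta) - Q))) `^ q^-1
       <= C%:E *
          (\int[mu]_x (g x `^ p * powR_infty (dist_set E x) beta)) `^ p^-1)%E.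
Proof.
move=> Hb ub [CD [CD0 Hdbl]] [CP [tau [CP0 tau1 HP]]] _ _ [c [c0 Hmass]] E0 _.
move=> p1 pq pQ qQ /ereal_sup_gt[_ [rho [_ [C1 [C11 Hrho]]] <-]].
rewrite lte_fin gt_max => /andP[rho_s rho_beta].
have p0 : 0 < p := lt_trans ltr01 p1.
have {}Hrho x r t : E x -> 0 < r -> r < t ->
    (mu (neighborhood E r `&` ball x t) / mu (ball x t)
      <= (C1 * (r / t) `^ rho)%:E)%E.
  by move=> Ex r0 rt; apply: Hrho; rewrite // ub gt0_muley ?ltry// lte_fin.
have {}rho_s : - rho < q / p * (Q - p + beta) - Q by lra.
have [C [C0 HC]] := hardy_sobolev Hb c0 Hmass CD0 Hdbl E0 C11 Hrho p1 pq
  rho_s rho_beta pQ CP0 tau1 HP qQ.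
exists C; split=> // f g Lf gf.
set I := (\int[mu]_x (g x `^ p * _))%E.
have [_ g0 _] := gf.
have I0 : (0 <= I)%E.
  by apply: integral_ge0 => x _; rewrite mule_ge0 ?poweR_ge0 ?powR_infty_ge0.
have {}HC A : 0 < A -> (I <= A%:E)%E -> _ := HC f g A Lf gf.
move: I I0 HC => [v|_ _|//]; last first.
  by rewrite poweRyr ?invr_eq0 ?gt_eqF// gt0_muley ?lte_fin// leey.
rewrite lee_fin le_eqVlt => /predU1P[<- HC|v0 HC]; last first.
  by rewrite poweR_EFin -EFinM; apply: HC.
rewrite poweR0r ?invr_eq0 ?gt_eqF// mule0.
apply/lee_addgt0Pr => e e0; rewrite add0e.
have eC : 0 < e / C by rewrite divr_gt0.
have Ce : C * (e / C) = e by rewrite mulrC divfK ?gt_eqF.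
have := HC ((e / C) `^ p); rewrite (powRK (lt0r_neq0 p0) (ltW eC)) Ce.
by apply; rewrite ?powR_gt0// lee_fin powR_ge0.
Qed.
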